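(* There is an absolute constant $C>0$ such that for every integer $\ell\ge 3$, with $n=\ell(\ell-1)/2$, there exists a set $U_n$ of at most $C\,n\log n$ points, each having integer coordinates $(x,y)$ with $1\le x\le \kappa_{\max}(\ell)$ and $1\le y\le C\ell$, such that $U_n$ is a universal point set for the $n$-vertex pseudoline arrangement graphs: every pseudoline arrangement graph with $n$ vertices has a planar straight-line drawing whose vertices are placed at distinct points of $U_n$.
   Context: A pseudoline is the image of a straight line under a homeomorphism of the plane onto itself. An arrangement of pseudolines is a finite set of pseudolines every two of which meet in exactly one point, which is a crossing (a point near which the two pseudolines look, up to homeomorphism, like two crossing lines); it is simple if distinct pairs have distinct crossing points. A pseudoline arrangement graph has the crossings of a simple pseudoline arrangement as vertices and edges between crossings consecutive along a common pseudoline; with $\ell$ pseudolines it has $\ell(\ell-1)/2$ vertices. A universal point set for a class of $n$-vertex graphs is a point set $U$ in the plane such that every graph in the class admits a straight-line drawing without edge crossings with its vertices mapped injectively into $U$. A wiring diagram $\mathcal D$ with $\ell$ pseudolines is a simple pseudoline arrangement in which the pseudolines lie on the horizontal tracks $y=1,\dots,\ell$ except near crossings at pairwise distinct $x$-coordinates, where the two pseudolines on adjacent tracks $i,i+1$ swap tracks. The $i$-th level $L_{\mathcal D}(i)$ is the set of crossings between tracks $i$ and $i+1$; $\kappa(\mathcal D)=\max_i|L_{\mathcal D}(i)|$, and $\kappa_{\max}(\ell)$ is the maximum of $\kappa(\mathcal D)$ over all wiring diagrams with $\ell$ pseudolines. *)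

(* Defs.v *)
From Stdlib Require Import Reals Lra Lia ZArith Arith List.
Open Scope R_scope.

Definition R2 : Type := (R * R)%type.

Definition dist2 (p q : R2) : R :=
  sqrt ((fst p - fst q) ^ 2 + (snd p - snd q) ^ 2).

Definition cont_on (A : R2 -> Prop) (f : R2 -> R2) : Prop :=
  forall x, A x -> forall eps, eps > 0 ->
    exists d, d > 0 /\ forall y, A y -> dist2 y x < d -> dist2 (f y) (f x) < eps.

Definition open_set (U : R2 -> Prop) : Prop :=
  forall x, U x -> exists r, r > 0 /\ forall y, dist2 y x < r -> U y.

Definition homeo (h : R2 -> R2) : Prop :=
  exists g : R2 -> R2,
    (forall x, g (h x) = x) /\ (forall y, h (g y) = y) /\
    cont_on (fun _ => True) h /\ cont_on (fun _ => True) g.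

Definition param_of (P : R2 -> Prop) (h : R2 -> R2) : Prop :=
  homeo h /\ forall q, P q <-> exists t, q = h (t, 0).

Definition is_pseudoline (P : R2 -> Prop) : Prop := exists h, param_of P h.

Definition unit_disk (y : R2) : Prop := dist2 y (0, 0) < 1.

Definition is_crossing (P Q : R2 -> Prop) (p : R2) : Prop :=
  P p /\ Q p /\
  exists (U : R2 -> Prop) (phi psi : R2 -> R2),
    open_set U /\ U p /\ phi p = (0, 0) /\
    (forall x, U x -> unit_disk (phi x) /\ psi (phi x) = x) /\
    (forall y, unit_disk y -> U (psi y) /\ phi (psi y) = y) /\
    cont_on U phi /\ cont_on unit_disk psi /\
    (forall x, U x -> (P x <-> snd (phi x) = 0)) /\
    (forall x, U x -> (Q x <-> fst (phi x) = 0)).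

Definition simple_arrangement (m : nat) (L : nat -> R2 -> Prop) : Prop :=
  (forall i, (i < m)%nat -> is_pseudoline (L i)) /\
  (forall i j, (i < m)%nat -> (j < m)%nat -> i <> j ->
     exists p, (forall q, (L i q /\ L j q) <-> q = p) /\ is_crossing (L i) (L j) p) /\
  (forall i j k l p, (i < m)%nat -> (j < m)%nat -> (k < m)%nat -> (l < m)%nat ->
     i <> j -> k <> l -> ~ ((i = k /\ j = l) \/ (i = l /\ j = k)) ->
     L i p -> L j p -> L k p -> L l p -> False).

Definition pa_vertex (m : nat) (L : nat -> R2 -> Prop) (p : R2) : Prop :=
  exists i j, (i < m)%nat /\ (j < m)%nat /\ i <> j /\ L i p /\ L j p.

Definition pa_edge (m : nat) (L : nat -> R2 -> Prop) (u v : R2) : Prop :=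
  u <> v /\ pa_vertex m L u /\ pa_vertex m L v /\
  exists i h a b, (i < m)%nat /\ param_of (L i) h /\ u = h (a, 0) /\ v = h (b, 0) /\
    forall c, pa_vertex m L (h (c, 0)) -> ~ (Rmin a b < c < Rmax a b).

Definition on_seg (a b z : R2) : Prop :=
  exists t, 0 <= t <= 1 /\
    z = (fst a + t * (fst b - fst a), snd a + t * (snd b - snd a)).

Definition ipt (z : Z * Z) : R2 := (IZR (fst z), IZR (snd z)).

Definition drawing_into (m : nat) (L : nat -> R2 -> Prop) (U : list (Z * Z))
    (f : R2 -> Z * Z) : Prop :=
  (forall v, pa_vertex m L v -> In (f v) U) /\
  (forall u v, pa_vertex m L u -> pa_vertex m L v -> f u = f v -> u = v) /\
  (forall w u v, pa_vertex m L w -> pa_edge m L u v -> w <> u -> w <> v ->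
     ~ on_seg (ipt (f u)) (ipt (f v)) (ipt (f w))) /\
  (forall u v u' v' z, pa_edge m L u v -> pa_edge m L u' v' ->
     on_seg (ipt (f u)) (ipt (f v)) z -> on_seg (ipt (f u')) (ipt (f v')) z ->
     ((u = u' /\ v = v') \/ (u = v' /\ v = u')) \/
     (exists w, (w = u \/ w = v) /\ (w = u' \/ w = v') /\ z = ipt (f w))).

(** Wiring diagrams, combinatorially: wires 0..l-1 start on tracks 1..l
    (list position k = track k+1); the diagram is the left-to-right sequence of
    the lower tracks i of its crossings (tracks i, i+1 swap). *)
Definition swap_tracks (st : list nat) (i : nat) : list nat :=
  map (fun k => if Nat.eqb k (i - 1) then nth i st 0%nat
                else if Nat.eqb k i then nth (i - 1) st 0%nat
                else nth k st 0%nat) (seq 0 (length st)).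

Fixpoint crossing_pairs (st : list nat) (w : list nat) : list (nat * nat) :=
  match w with
  | nil => nil
  | i :: w' => (nth (i - 1) st 0%nat, nth i st 0%nat) :: crossing_pairs (swap_tracks st i) w'
  end.

Definition same_pair (a b : nat) (p : nat * nat) : bool :=
  (Nat.eqb (fst p) a && Nat.eqb (snd p) b) || (Nat.eqb (fst p) b && Nat.eqb (snd p) a).

Definition is_wiring (l : nat) (w : list nat) : Prop :=
  Forall (fun i => (1 <= i <= l - 1)%nat) w /\
  forall a b, (a < b < l)%nat ->
    length (filter (same_pair a b) (crossing_pairs (seq 0 l) w)) = 1%nat.

Definition level_size (w : list nat) (i : nat) : nat := count_occ Nat.eq_dec w i.

Definition kappa (l : nat) (w : list nat) : nat :=
  list_max (map (level_size w) (seq 1 (l - 1))).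

Definition is_kappa_max (l k : nat) : Prop :=
  (exists w, is_wiring l w /\ kappa l w = k) /\
  (forall w, is_wiring l w -> (kappa l w <= k)%nat).

(* Main.v *)
Require Import Defs.
From Stdlib Require Import Reals ZArith Arith List.
From Stdlib Require Import Lra Lia Permutation Bool Sorted Classical IndefiniteDescription.
Open Scope R_scope.

(** Orient the pseudolines, record on each of them the order of its crossings, and record for
    each pair the side of one line in which the other ends. Computing the side of line i that
    contains the crossing of j and k along j and along k must give the same answer; this
    condition on triples already forces a sweep of the arrangement, hence a wiring diagram
    with the same local orders. Drawing the j-th crossing of level i at abscissa j of the row
    of level i is planar for every increasing choice of rows, because between two rows the
    edges follow one track from left to right. With a_i crossings on level i, give level i
    a block of a_i/l+1 consecutive rows: if row r holds about 2l times the sum of the powers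
    of two dividing r, each block contains a row with at least a_i points, 2l rows are enough,
    and they hold O(l^2 log l) points. *)

(** * Sweeping a consistent system of crossing orders *)

(** The obstacle is that an arrangement is topological while [is_kappa_max] speaks of words of
    adjacent swaps. No region of the plane is swept: topology enters only through the intermediate
    value theorem along segments, which shows that a line changes sides at each crossing and that
    betweenness on a line does not depend on its parametrization. The rest is extracted from signs.
    Once the lines are sorted by their starts, the side conditions say that the crossings of three
    lines come in lexicographic order or in its reverse, on all three lines at once. This is the
    signotope condition of [pseudoline_orders], and it keeps the sweep from getting stuck. The point
    set must be fixed before the level sizes are known; only their sum is bounded, by [l * l]. A
    level of size about [l * s] claims [s] consecutive rows wherever they happen to lie, so every
    run of [s] rows must contain one of capacity about [l * s]. Multiples of powers of two achieve
    this at all scales, and each of the [log2 (2 l) + 1] scales adds at most [2 l] to the sum of the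
    ruler values: hence the logarithm. *)

Definition pseudoline_orders (m : nat) (T : nat -> nat -> R) (lab : nat -> Z) : Prop :=
  (forall i j k, (i < m)%nat -> (j < m)%nat -> (k < m)%nat ->
     i <> j -> i <> k -> j <> k -> T i j <> T i k) /\
  (forall i j k, (i < m)%nat -> (j < m)%nat -> (k < m)%nat ->
     (lab i < lab j < lab k)%Z ->
     (T i j < T i k <-> T j i < T j k) /\ (T i j < T i k <-> T k i < T k j)).

(** [lab] is the order of the lines at the left end and [pos] their current order, so inverted pairs
    are those already crossed. Both are functions into Z so that negating them turns the picture
    upside down. *)
Definition inverted (lab pos : nat -> Z) (a b : nat) : Prop :=
  ((lab a < lab b /\ pos b < pos a) \/ (lab b < lab a /\ pos a < pos b))%Z.

(** The last clause makes the set of past crossings an initial segment of every line. *)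
Definition sweep_front (m : nat) (T : nat -> nat -> R) (lab pos : nat -> Z) : Prop :=
  (forall i j, (i < m)%nat -> (j < m)%nat -> lab i = lab j -> i = j) /\
  (forall i j, (i < m)%nat -> (j < m)%nat -> pos i = pos j -> i = j) /\
  (forall i j k, (i < m)%nat -> (j < m)%nat -> (k < m)%nat -> i <> j -> i <> k ->
     inverted lab pos i j -> T i k < T i j -> inverted lab pos i k).

Definition next_crossing (m : nat) (T : nat -> nat -> R) (lab pos : nat -> Z)
    (a b : nat) : Prop :=
  (b < m)%nat /\ b <> a /\ ~ inverted lab pos a b /\
  forall k, (k < m)%nat -> k <> a -> T a k < T a b -> inverted lab pos a k.

Lemma finite_argmin (f : nat -> R) (P : nat -> Prop) (m : nat) :
  (forall i, P i \/ ~ P i) ->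
  (forall i, (i < m)%nat -> ~ P i) \/
  exists i, (i < m)%nat /\ P i /\ forall j, (j < m)%nat -> P j -> f i <= f j.
Proof.
  intros dec; induction m as [|m IH]; [left; intros; lia|].
  destruct (dec m) as [Pm|Pm], IH as [none|[x [Hx [Px Mx]]]].
  - right; exists m; repeat split; auto. intros j Hj Pj.
    destruct (Nat.eq_dec j m) as [->|]; [lra|]. exfalso; apply (none j); auto; lia.
  - right. destruct (Rle_dec (f x) (f m)).
    + exists x; repeat split; auto. intros y Hy Py.
      destruct (Nat.eq_dec y m) as [->|]; [lra|apply Mx; auto; lia].
    + exists m; repeat split; auto. intros y Hy Py.
      destruct (Nat.eq_dec y m) as [->|]; [lra|].
      assert (f x <= f y) by (apply Mx; auto; lia). lra.
  - left. intros j Hj Pj. destruct (Nat.eq_dec j m) as [->|]; [auto|].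
    apply (none j); auto; lia.
  - right; exists x; repeat split; auto. intros y Hy Py.
    destruct (Nat.eq_dec y m) as [->|]; [tauto|apply Mx; auto; lia].
Qed.

Lemma inverted_dec lab pos a b : inverted lab pos a b \/ ~ inverted lab pos a b.
Proof. unfold inverted; lia. Qed.

Lemma inverted_sym lab pos a b : inverted lab pos a b <-> inverted lab pos b a.
Proof. unfold inverted; lia. Qed.

Lemma next_crossing_exists m T lab pos a c :
  (c < m)%nat -> c <> a -> ~ inverted lab pos a c ->
  exists b, next_crossing m T lab pos a b.
Proof.
  intros Hc ca nI.
  destruct (finite_argmin (T a) (fun b => b <> a /\ ~ inverted lab pos a b) m)
    as [none|[b [Hb [[ba nb] Mb]]]].
  - intros i; unfold inverted; lia.
  - exfalso; apply (none c); auto.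
  - exists b; repeat split; auto. intros k Hk ka lt.
    destruct (inverted_dec lab pos a k) as [|nk]; auto.
    specialize (Mb k Hk (conj ka nk)). lra.
Qed.

Lemma next_crossing_lt m T lab pos a b c :
  pseudoline_orders m T lab -> (a < m)%nat ->
  next_crossing m T lab pos a b ->
  (c < m)%nat -> c <> a -> c <> b -> ~ inverted lab pos a c -> T a b < T a c.
Proof.
  intros [dist _] Ha [Hb [ba [nb Mb]]] Hc ca cb nc.
  assert (T a b <> T a c) by (apply dist; auto).
  destruct (Rlt_dec (T a c) (T a b)); [|lra].
  exfalso; apply nc, Mb; auto.
Qed.

(** Suppose [c <> b] and the next crossing [d] of [b] goes down. The triple [a], [b], [c] excludes
    [d = a]. Otherwise [d] is below and [c] above both [a] and [b], in label and in position, and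
    the triples with [c] and [d] give [T c a < T c d < T c b]. Whether or not [a] and [b] have
    crossed, this contradicts the triple [a], [b], [c]. *)
Lemma next_crossing_up m T lab pos a b c :
  pseudoline_orders m T lab -> sweep_front m T lab pos ->
  (a < m)%nat -> (b < m)%nat -> pos b = (pos a + 1)%Z ->
  next_crossing m T lab pos a c -> (lab a < lab c)%Z ->
  c = b \/ exists d, next_crossing m T lab pos b d /\ (lab b < lab d)%Z.
Proof.
  intros ord [labinj [posinj down]] Ha Hb adj nac Hac.
  destruct (Nat.eq_dec c b) as [|cb]; [auto|right].
  pose proof (fun x => next_crossing_lt m T lab pos a c x ord Ha nac) as lta.
  destruct nac as [Hc [ca [nIac _]]].
  assert (ab : a <> b) by (intros ->; lia).
  assert (pc : (pos b < pos c)%Z).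
  { unfold inverted in nIac. assert (pos c <> pos a) by (intros E; apply ca, posinj; auto).
    assert (pos c <> pos b) by (intros E; apply cb, posinj; auto). lia. }
  assert (labne : forall x y, (x < m)%nat -> (y < m)%nat -> x <> y -> lab x <> lab y)
    by (intros x y Hx Hy xy E; apply xy, labinj; auto).
  assert (posne : forall x y, (x < m)%nat -> (y < m)%nat -> x <> y -> pos x <> pos y)
    by (intros x y Hx Hy xy E; apply xy, posinj; auto).
  pose proof ord as [dist tri].
  (* Otherwise [b] and [c] have crossed, and closure of the front along [c] puts the crossing with
     [a] in the past too. *)
  assert (lbc : (lab b < lab c)%Z).
  { pose proof (labne b c Hb Hc (not_eq_sym cb)).
    destruct (Z.lt_ge_cases (lab b) (lab c)) as [|ge]; [assumption|exfalso].
    assert (T a c < T a b) by (apply lta; auto; unfold inverted; lia).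
    apply nIac, inverted_sym. apply (down c b a); auto.
    - unfold inverted; lia.
    - destruct (tri a c b) as [E1 E2]; auto; try lia. tauto. }
  destruct (next_crossing_exists m T lab pos b c) as [d nbd]; auto.
  { unfold inverted; lia. }
  exists d; split; auto.
  pose proof (fun x => next_crossing_lt m T lab pos b d x ord Hb nbd) as ltb.
  destruct nbd as [Hd [db [nIbd Mb]]].
  pose proof (labne d b Hd Hb db).
  destruct (Z.lt_ge_cases (lab b) (lab d)) as [|ge]; [assumption|exfalso].
  assert (dc : d <> c) by (intros ->; lia).
  assert (pd : (pos d < pos b)%Z).
  { pose proof (posne d b Hd Hb db). unfold inverted in nIbd. lia. }
  destruct (Nat.eq_dec d a) as [->|da].
  { assert (T a c < T a b) by (apply lta; auto; unfold inverted; lia).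
    assert (T b a < T b c) by (apply ltb; auto; unfold inverted; lia).
    destruct (tri a b c) as [E1 E2]; auto; try lia.
    apply E1 in H1. lra. }
  pose proof (posne d a Hd Ha da). pose proof (labne d a Hd Ha da).
  (* Otherwise [d] and [a] have crossed, and closure along [d] puts the crossing with [b] in the
     past too. *)
  assert (lda : (lab d < lab a)%Z).
  { destruct (Z.lt_ge_cases (lab d) (lab a)) as [|gt]; [assumption|exfalso].
    assert (T b d < T b a) by (apply ltb; auto; unfold inverted; lia).
    apply nIbd, inverted_sym. apply (down d a b); auto.
    - unfold inverted; lia.
    - destruct (tri a d b) as [E1 E2]; auto; try lia.
      assert (T d b <> T d a) by (apply dist; auto).
      destruct (Rlt_dec (T d a) (T d b)) as [lt|]; [|lra].
      apply E1, E2 in lt. lra. }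
  assert (acd : T a c < T a d) by (apply lta; auto; unfold inverted; lia).
  assert (bdc : T b d < T b c) by (apply ltb; auto; unfold inverted; lia).
  assert (cac : T c a < T c d).
  { destruct (tri d a c) as [E1 E2]; auto; try lia.
    assert (T c a <> T c d) by (apply dist; auto).
    destruct (Rlt_dec (T c d) (T c a)) as [lt|]; [|lra].
    apply E2, E1 in lt. lra. }
  assert (cdb : T c d < T c b).
  { destruct (tri d b c) as [E1 E2]; auto; try lia. tauto. }
  pose proof (labne a b Ha Hb ab).
  destruct (Z.lt_ge_cases (lab a) (lab b)).
  - assert (T a c < T a b) by (apply lta; auto; unfold inverted; lia).
    destruct (tri a b c) as [E1 E2]; auto; try lia.
    assert (T a b < T a c) by (apply E2; lra). lra.
  - assert (T a b < T a c).
    { assert (T a b <> T a c) by (apply dist; auto).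
      destruct (Rlt_dec (T a c) (T a b)); [|lra].
      exfalso; apply nIac. apply (down a b c); auto. unfold inverted; lia. }
    destruct (tri b a c) as [E1 E2]; auto; try lia.
    assert (T c b < T c a) by tauto. lra.
Qed.

(** Reversing the labels exchanges the outer lines of a triple and negates each of the three
    inequalities; distinctness makes the negations strict again. *)
Lemma pseudoline_orders_opp m T lab :
  (forall i j, (i < m)%nat -> (j < m)%nat -> lab i = lab j -> i = j) ->
  pseudoline_orders m T lab -> pseudoline_orders m T (fun i => - lab i)%Z.
Proof.
  intros inj [dist tri]; split; [exact dist|].
  intros i j k Hi Hj Hk Hlt.
  assert (i <> j /\ i <> k /\ j <> k) as [ij [ik jk]].
  { repeat split; intros ->; lia. }
  destruct (tri k j i) as [E1 E2]; auto; try lia.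
  assert (T i j <> T i k) by (apply dist; auto).
  assert (T j i <> T j k) by (apply dist; auto).
  assert (T k i <> T k j) by (apply dist; auto).
  split; split; intros lt.
  - destruct (Rlt_dec (T j k) (T j i)) as [l2|]; [|lra]. apply E1, E2 in l2. lra.
  - destruct (Rlt_dec (T i k) (T i j)) as [l2|]; [|lra]. apply E2, E1 in l2. lra.
  - destruct (Rlt_dec (T k j) (T k i)) as [l2|]; [|lra]. apply E2 in l2. lra.
  - destruct (Rlt_dec (T i k) (T i j)) as [l2|]; [|lra]. apply E2 in l2. lra.
Qed.

Lemma inverted_opp lab pos a b :
  inverted (fun i => - lab i)%Z (fun i => - pos i)%Z a b <-> inverted lab pos a b.
Proof. unfold inverted; lia. Qed.

Lemma sweep_front_opp m T lab pos :
  sweep_front m T lab pos -> sweep_front m T (fun i => - lab i)%Z (fun i => - pos i)%Z.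
Proof.
  intros [li [pi down]]; repeat split.
  - intros; apply li; auto; lia.
  - intros; apply pi; auto; lia.
  - intros i j k Hi Hj Hk ij ik Hinv lt. apply inverted_opp.
    rewrite inverted_opp in Hinv. exact (down i j k Hi Hj Hk ij ik Hinv lt).
Qed.

Lemma next_crossing_opp m T lab pos a b :
  next_crossing m T (fun i => - lab i)%Z (fun i => - pos i)%Z a b <->
  next_crossing m T lab pos a b.
Proof.
  unfold next_crossing. rewrite inverted_opp.
  split; intros [H1 [H2 [H3 H4]]]; repeat split; auto; intros k Hk ka lt.
  - apply inverted_opp; auto.
  - apply inverted_opp; auto.
Qed.

(** This is [next_crossing_up] in the picture turned upside down. *)
Lemma next_crossing_down m T lab pos a b d :
  pseudoline_orders m T lab -> sweep_front m T lab pos ->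
  (a < m)%nat -> (b < m)%nat -> pos b = (pos a + 1)%Z ->
  next_crossing m T lab pos b d -> (lab d < lab b)%Z ->
  d = a \/ exists c, next_crossing m T lab pos a c /\ (lab c < lab a)%Z.
Proof.
  intros ord fr Ha Hb adj nbd Hbd.
  destruct (next_crossing_up m T (fun i => - lab i)%Z (fun i => - pos i)%Z b a d)
    as [|[c [nc lc]]]; auto.
  - apply pseudoline_orders_opp; auto. apply fr.
  - apply sweep_front_opp; auto.
  - lia.
  - apply next_crossing_opp; auto.
  - lia.
  - right; exists c; split; [|lia]. rewrite next_crossing_opp in nc; auto.
Qed.

(* The topmost wire whose next crossing goes up meets there the wire just above it. *)
Lemma sweep_ready m T lab pos a0 b0 :
  pseudoline_orders m T lab -> sweep_front m T lab pos ->
  (forall i, (i < m)%nat -> (0 <= pos i < Z.of_nat m)%Z) ->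
  (forall p, (0 <= p < Z.of_nat m)%Z -> exists i, (i < m)%nat /\ pos i = p) ->
  (a0 < m)%nat -> (b0 < m)%nat -> a0 <> b0 -> ~ inverted lab pos a0 b0 ->
  exists a b, (a < m)%nat /\ (b < m)%nat /\ (lab a < lab b)%Z /\ pos b = (pos a + 1)%Z /\
    next_crossing m T lab pos a b /\ next_crossing m T lab pos b a.
Proof.
  intros ord fr bnd surj Ha0 Hb0 ne nI.
  pose proof fr as [inj' [inj _]].
  assert (labne : forall x y, (x < m)%nat -> (y < m)%nat -> x <> y -> lab x <> lab y)
    by (intros x y Hx Hy xy E; apply xy, inj'; auto).
  assert (posne : forall x y, (x < m)%nat -> (y < m)%nat -> x <> y -> pos x <> pos y)
    by (intros x y Hx Hy xy E; apply xy, inj; auto).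
  assert (fwd : forall a c, (a < m)%nat -> next_crossing m T lab pos a c -> (lab a < lab c)%Z ->
            exists b, (b < m)%nat /\ pos b = (pos a + 1)%Z).
  { intros a c Ha [Hc [ca [nac _]]] lt. unfold inverted in nac.
    pose proof (posne a c Ha Hc (not_eq_sym ca)). pose proof (bnd c Hc). pose proof (bnd a Ha).
    destruct (surj (pos a + 1)%Z) as [b Hb]; [lia|]. eauto. }
  (* If the next crossing of a wire goes down, it is with a lower wire, which still has a crossing
     ahead; the descent must stop at a wire that goes up. *)
  assert (start : exists a c, (a < m)%nat /\ next_crossing m T lab pos a c /\ (lab a < lab c)%Z).
  {
    assert (low : forall n a, (a < m)%nat -> (pos a < Z.of_nat n)%Z ->
              (exists c, next_crossing m T lab pos a c) ->
              exists a c, (a < m)%nat /\ next_crossing m T lab pos a c /\ (lab a < lab c)%Z).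
    { induction n as [|n IH]; intros a Ha pa [c nac].
      - pose proof (bnd a Ha). lia.
      - destruct (Z.lt_ge_cases (lab a) (lab c)) as [|ge]; [eauto|].
        pose proof nac as [Hc [ca [nc _]]].
        pose proof (labne a c Ha Hc (not_eq_sym ca)).
        pose proof (posne a c Ha Hc (not_eq_sym ca)).
        apply (IH c); auto.
        + unfold inverted in nc; lia.
        + apply next_crossing_exists with a; auto. rewrite inverted_sym; auto. }
    apply (low m a0); auto; [apply bnd; auto|].
    apply next_crossing_exists with b0; auto. }
  (* Climb from a wire that goes up to the wire just above it, as long as that one goes up too. *)
  assert (top : forall n a c, (a < m)%nat -> (Z.of_nat m - pos a < Z.of_nat n)%Z ->
            next_crossing m T lab pos a c -> (lab a < lab c)%Z ->
            exists a b, (a < m)%nat /\ (b < m)%nat /\ (lab a < lab b)%Z /\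
              pos b = (pos a + 1)%Z /\ next_crossing m T lab pos a b /\
              ~ exists d, next_crossing m T lab pos b d /\ (lab b < lab d)%Z).
  { induction n as [|n IH]; intros a c Ha pa nac lt.
    - pose proof (bnd a Ha). lia.
    - destruct (fwd a c Ha nac lt) as [b [Hb pb]].
      assert (dec : (exists d, next_crossing m T lab pos b d /\ (lab b < lab d)%Z) \/
                    c = b /\ ~ (exists d, next_crossing m T lab pos b d /\ (lab b < lab d)%Z)).
      { destruct (next_crossing_up m T lab pos a b c) as [->|]; auto.
        destruct (next_crossing_exists m T lab pos b a) as [d nd]; auto.
        - intros ->; lia.
        - rewrite inverted_sym. apply nac.
        - destruct (Z.lt_ge_cases (lab b) (lab d)) as [|ge]; [eauto|].
          right; split; auto. intros [d' [nd' lt']].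
          assert (d <> d') by (intros ->; lia).
          pose proof (next_crossing_lt m T lab pos b d d' ord Hb nd) as L1.
          pose proof (next_crossing_lt m T lab pos b d' d ord Hb nd') as L2.
          destruct nd as [? [? [? _]]], nd' as [? [? [? _]]].
          assert (T b d < T b d') by auto. assert (T b d' < T b d) by auto. lra. }
      destruct dec as [[d [nd ltd]]|[-> nd]].
      + apply (IH b d); auto. lia.
      + exists a, b; repeat split; auto; apply nac. }
  destruct start as [a1 [c1 [Ha1 [n1 l1]]]].
  destruct (top (S m - Z.to_nat (pos a1))%nat a1 c1) as [a [b [Ha [Hb [lt [adj [nab noup]]]]]]]; auto.
  { pose proof (bnd a1 Ha1). lia. }
  exists a, b; repeat split; auto; try apply nab.
  - intros ->; lia.
  - rewrite inverted_sym; apply nab.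
  - destruct (next_crossing_exists m T lab pos b a) as [d nd]; auto.
    + intros ->; lia.
    + rewrite inverted_sym. apply nab.
    + assert (lab d <> lab b) by (apply labne; auto; apply nd).
      destruct (Z.lt_ge_cases (lab b) (lab d)) as [|ge]; [exfalso; eauto|].
      (* The next crossing of [b] goes down. If it were not with [a], the next crossing of [a] would
         go down, but that crossing is [b], above. *)
      destruct (next_crossing_down m T lab pos a b d) as [->|[c [nc lc]]]; auto.
      * lia.
      * apply nd.
      * exfalso. assert (c <> b) by (intros ->; lia).
        pose proof (next_crossing_lt m T lab pos a c b ord Ha nc) as L1.
        pose proof (next_crossing_lt m T lab pos a b c ord Ha nab) as L2.
        destruct nc as [? [? [? _]]], nab as [? [? [? _]]].
        assert (T a b < T a c) by auto. assert (T a c < T a b) by auto. lra.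
Qed.

(** * Running the sweep on lists of tracks *)

Fixpoint index (x : nat) (l : list nat) : nat :=
  match l with
  | nil => 0%nat
  | y :: l' => if Nat.eqb y x then 0%nat else S (index x l')
  end.

Lemma index_spec x l :
  In x l -> (index x l < length l)%nat /\ nth (index x l) l 0%nat = x.
Proof.
  induction l as [|y l IH]; simpl; [tauto|]. intros H.
  destruct (Nat.eqb_spec y x) as [->|ne]; [split; [lia|auto]|].
  destruct H as [|H]; [congruence|]. destruct (IH H); split; [lia|auto].
Qed.

Lemma index_nth l p : NoDup l -> (p < length l)%nat -> index (nth p l 0%nat) l = p.
Proof.
  intros nd Hp. destruct (index_spec (nth p l 0%nat) l) as [H1 H2]; [apply nth_In; auto|].
  apply (proj1 (NoDup_nth l 0%nat) nd); auto.
Qed.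

Definition wires (m : nat) (st : list nat) : Prop :=
  NoDup st /\ length st = m /\ forall x, In x st <-> (x < m)%nat.

Lemma swap_tracks_length st i : length (swap_tracks st i) = length st.
Proof. unfold swap_tracks. rewrite length_map, length_seq. reflexivity. Qed.

Lemma nth_swap_tracks st i k : (k < length st)%nat ->
  nth k (swap_tracks st i) 0%nat =
  if Nat.eqb k (i - 1) then nth i st 0%nat
  else if Nat.eqb k i then nth (i - 1) st 0%nat else nth k st 0%nat.
Proof.
  intros Hk. unfold swap_tracks.
  set (F := fun k : nat => if Nat.eqb k (i - 1) then _ else _).
  rewrite (nth_indep _ 0%nat (F 0%nat)) by (rewrite length_map, length_seq; auto).
  rewrite (map_nth F), seq_nth by auto. reflexivity.
Qed.

Lemma wires_swap_tracks m st i :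
  wires m st -> (1 <= i < m)%nat -> wires m (swap_tracks st i).
Proof.
  intros [nd [len mem]] Hi.
  pose proof (proj1 (NoDup_nth st 0%nat) nd) as inj.
  assert (nd' : NoDup (swap_tracks st i)).
  { apply (NoDup_nth _ 0%nat). rewrite swap_tracks_length. intros p q Hp Hq.
    rewrite !nth_swap_tracks by auto.
    destruct (Nat.eqb_spec p (i - 1)), (Nat.eqb_spec q (i - 1)), (Nat.eqb_spec p i),
      (Nat.eqb_spec q i); intros E; try lia; apply inj in E; lia. }
  split; [exact nd'|split; [rewrite swap_tracks_length; auto|]].
  assert (inc : incl (swap_tracks st i) st).
  { intros x Hx. apply (In_nth _ _ 0%nat) in Hx. destruct Hx as [p [Hp <-]].
    rewrite swap_tracks_length in Hp. rewrite nth_swap_tracks by auto.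
    destruct (Nat.eqb p (i - 1)), (Nat.eqb p i); apply nth_In; lia. }
  intros x; rewrite <- mem; split; [apply inc|].
  apply NoDup_length_incl; auto. rewrite swap_tracks_length; auto.
Qed.

Lemma index_swap_tracks m st i x :
  wires m st -> (1 <= i < m)%nat -> (x < m)%nat ->
  index x (swap_tracks st i) =
  if Nat.eqb x (nth (i - 1) st 0%nat) then i
  else if Nat.eqb x (nth i st 0%nat) then (i - 1)%nat else index x st.
Proof.
  intros W Hi Hx. pose proof W as [nd [len mem]].
  destruct (wires_swap_tracks m st i W Hi) as [nd' [len' _]].
  assert (key : forall p, (p < m)%nat -> nth p (swap_tracks st i) 0%nat = x ->
            index x (swap_tracks st i) = p).
  { intros p Hp <-. apply index_nth; auto. lia. }
  destruct (index_spec x st) as [Hp Hxp]; [apply mem; auto|].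
  destruct (Nat.eqb_spec x (nth (i - 1) st 0%nat)) as [E|n1];
    [|destruct (Nat.eqb_spec x (nth i st 0%nat)) as [E|n2]]; apply key; try lia;
    rewrite nth_swap_tracks by lia.
  - rewrite Nat.eqb_refl. destruct (Nat.eqb_spec i (i - 1)); [lia|auto].
  - rewrite Nat.eqb_refl. auto.
  - destruct (Nat.eqb_spec (index x st) (i - 1)) as [E|]; [rewrite E in Hxp; congruence|].
    destruct (Nat.eqb_spec (index x st) i) as [E|]; [rewrite E in Hxp; congruence|auto].
Qed.

Lemma filter_length_le {A} (f g : A -> bool) l :
  (forall x, In x l -> f x = true -> g x = true) -> (length (filter f l) <= length (filter g l))%nat.
Proof.
  induction l as [|x l IH]; simpl; auto. intros H.
  specialize (IH (fun y Hy => H y (or_intror Hy))).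
  destruct (f x) eqn:E; [rewrite (H x (or_introl eq_refl) E); simpl; lia|].
  destruct (g x); simpl; lia.
Qed.

Lemma filter_length_lt {A} (f g : A -> bool) l y :
  (forall x, In x l -> f x = true -> g x = true) -> In y l -> f y = false -> g y = true ->
  (length (filter f l) < length (filter g l))%nat.
Proof.
  intros H Hy fy gy. induction l as [|x l IH]; simpl in *; [tauto|].
  pose proof (filter_length_le f g l (fun y Hy => H y (or_intror Hy))).
  specialize (IH (fun y Hy => H y (or_intror Hy))).
  destruct Hy as [->|Hy]; [rewrite fy, gy; simpl; lia|].
  specialize (IH Hy). destruct (f x) eqn:E; [rewrite (H x (or_introl eq_refl) E); simpl; lia|].
  destruct (g x); simpl; lia.
Qed.

(** Positions count from 0: level [i] of a word exchanges the positions [i - 1] and [i]. *)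
Definition track (st : list nat) (x : nat) : Z := Z.of_nat (index x st).

Definition uncrossed (st : list nat) (p : nat * nat) : bool :=
  (fst p <? snd p)%nat && (index (fst p) st <? index (snd p) st)%nat.

Definition joins (p : nat * nat) (i j : nat) : Prop := p = (i, j) \/ p = (j, i).

(** Pairs without a common line are unconstrained, so the word only has to be a linear extension of
    the orders along the lines. *)
Definition chronological (T : nat -> nat -> R) (cp : list (nat * nat)) : Prop :=
  ForallOrdPairs (fun p q => forall i j k, joins p i j -> joins q i k -> T i j < T i k) cp.

Lemma same_pair_joins a b p : same_pair a b p = true <-> joins p a b.
Proof.
  destruct p as [x y]; unfold same_pair, joins; simpl.
  rewrite orb_true_iff, !andb_true_iff, !Nat.eqb_eq.
  split; intros [H|H]; try (injection H; auto); destruct H as [-> ->]; auto.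
Qed.

Lemma filter_nil_joins a b cp :
  length (filter (same_pair a b) cp) = 0%nat -> forall p, In p cp -> ~ joins p a b.
Proof.
  intros H p Hp J. apply length_zero_iff_nil in H.
  assert (In p (filter (same_pair a b) cp)) by (apply filter_In; split; auto; apply same_pair_joins; auto).
  rewrite H in H0. destruct H0.
Qed.

(** Induction on the number of pairs still to be crossed. The equation on counts says that the
    remaining word crosses exactly these pairs, once each; it is also what shows that the new first
    crossing precedes all later ones. *)
Lemma sweep_complete m T :
  pseudoline_orders m T Z.of_nat ->
  forall n st, wires m st -> sweep_front m T Z.of_nat (track st) ->
  (length (filter (uncrossed st) (list_prod (seq 0 m) (seq 0 m))) < n)%nat ->
  exists w, Forall (fun i => (1 <= i <= m - 1)%nat) w /\
    (forall p, In p (crossing_pairs st w) -> (fst p < snd p < m)%nat) /\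
    (forall a b, (a < b < m)%nat ->
      length (filter (same_pair a b) (crossing_pairs st w)) =
      if (index a st <? index b st)%nat then 1%nat else 0%nat) /\
    chronological T (crossing_pairs st w).
Proof.
  intros ord. induction n as [|n IH]; intros st W fr Hn; [lia|].
  destruct (filter (uncrossed st) (list_prod (seq 0 m) (seq 0 m))) as [|[a0 b0] l] eqn:E.
  - exists nil; simpl. repeat split; auto; try tauto; try constructor.
    intros a b Hab. destruct (Nat.ltb_spec (index a st) (index b st)); [|auto].
    assert (In (a, b) (filter (uncrossed st) (list_prod (seq 0 m) (seq 0 m)))) as H1.
    { apply filter_In; split; [apply in_prod; apply in_seq; lia|].
      unfold uncrossed; simpl. apply andb_true_iff; split; apply Nat.ltb_lt; lia. }
    rewrite E in H1; destruct H1.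
  - assert (In (a0, b0) (filter (uncrossed st) (list_prod (seq 0 m) (seq 0 m)))) as H0
      by (rewrite E; left; auto).
    apply filter_In in H0. destruct H0 as [H0 H1]. apply in_prod_iff in H0.
    rewrite !in_seq in H0. unfold uncrossed in H1; simpl in H1.
    apply andb_true_iff in H1. rewrite !Nat.ltb_lt in H1.
    rewrite <- E in Hn; clear E l.
    pose proof W as [nd [len mem]].
    assert (idx : forall x, (x < m)%nat -> (index x st < m)%nat /\ nth (index x st) st 0%nat = x).
    { intros x Hx. rewrite <- len. apply index_spec, mem; auto. }
    destruct (sweep_ready m T Z.of_nat (track st) a0 b0)
      as [a [b [Ha [Hb [lab [adj [nab nba]]]]]]]; auto; try lia.
    { intros i Hi. unfold track. pose proof (idx i Hi). lia. }
    { intros p Hp. exists (nth (Z.to_nat p) st 0%nat). split.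
      - apply mem, nth_In; lia.
      - unfold track. rewrite index_nth; auto; lia. }
    { unfold inverted, track; lia. }
    unfold track in adj.
    remember (index b st) as i eqn:Ib in *.
    assert (Hi : (1 <= i < m)%nat) by (pose proof (idx b Hb); lia).
    assert (Ea : nth (i - 1) st 0%nat = a).
    { replace (i - 1)%nat with (index a st) by lia. apply idx; auto. }
    assert (Eb : nth i st 0%nat = b) by (rewrite Ib; apply idx; auto).
    remember (swap_tracks st i) as st' eqn:Est.
    assert (W' : wires m st') by (subst st'; apply wires_swap_tracks; auto).
    assert (ab : a <> b) by lia.
    assert (tr : forall x, (x < m)%nat -> index x st' =
              if Nat.eqb x a then i else if Nat.eqb x b then (i - 1)%nat else index x st).
    { intros x Hx. rewrite Est, (index_swap_tracks m); auto. rewrite Ea, Eb; auto. }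
    assert (Ia : index a st = (i - 1)%nat) by lia.
    symmetry in Ib.
    assert (ne : forall x, (x < m)%nat -> x <> a -> x <> b ->
              index x st <> (i - 1)%nat /\ index x st <> i).
    { intros x Hx xa xb. pose proof (idx x Hx) as [_ Ex]. split; intros F; rewrite F in Ex; congruence. }
    (* Since [a] and [b] are on adjacent tracks, the swap changes the status of no other pair. *)
    assert (inv : forall x y, (x < m)%nat -> (y < m)%nat ->
              (inverted Z.of_nat (track st') x y <->
               inverted Z.of_nat (track st) x y \/ joins (a, b) x y)).
    { intros x y Hx Hy. unfold inverted, track, joins. rewrite (tr x Hx), (tr y Hy).
      pose proof (ne x Hx). pose proof (ne y Hy).
      destruct (Nat.eqb_spec x a), (Nat.eqb_spec x b), (Nat.eqb_spec y a), (Nat.eqb_spec y b);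
        subst; try (exfalso; lia);
        (split; [intros Q; try (right; auto; fail); left; lia
                |intros [Q|[Q|Q]]; try lia; injection Q; lia]). }
    (* Closure survives because the crossing is next on [a] and also next on [b]. *)
    assert (fr' : sweep_front m T Z.of_nat (track st')).
    { split; [intros; lia|]. split.
      - intros x y Hx Hy Exy. unfold track in Exy. destruct W' as [_ [_ mem']].
        rewrite <- (proj2 (index_spec x st' (proj2 (mem' x) Hx))),
                <- (proj2 (index_spec y st' (proj2 (mem' y) Hy))). f_equal. lia.
      - intros x y z Hx Hy Hz xy xz Hinv lt. apply inv; auto. apply inv in Hinv; auto.
        left. destruct Hinv as [Hinv|[J|J]].
        + apply (proj2 (proj2 fr) x y z); auto.
        + injection J as -> ->. apply nab; auto.
        + injection J as -> ->. apply nba; auto. }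
    destruct (IH st' W' fr') as [w [Hw [Hp [Hc Hch]]]].
    { eapply Nat.lt_le_trans; [|apply Nat.lt_succ_r; exact Hn].
      apply (filter_length_lt _ _ _ (a, b)).
      - intros [x y] Hin. apply in_prod_iff in Hin. rewrite !in_seq in Hin.
        unfold uncrossed; simpl. rewrite !andb_true_iff, !Nat.ltb_lt.
        intros [xy Hxy]. split; auto.
        assert (nI : ~ inverted Z.of_nat (track st') x y) by (unfold inverted, track; lia).
        rewrite inv in nI by lia. unfold inverted, track in nI.
        assert (index x st <> index y st); [|lia].
        intros F. pose proof (proj2 (idx x ltac:(lia))) as E1.
        pose proof (proj2 (idx y ltac:(lia))). rewrite F in E1. lia.
      - apply in_prod; apply in_seq; lia.
      - unfold uncrossed; simpl. rewrite (tr a), (tr b) by auto.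
        rewrite !Nat.eqb_refl. destruct (Nat.eqb_spec b a); [lia|].
        apply andb_false_iff; right. apply Nat.ltb_ge; lia.
      - unfold uncrossed; simpl. apply andb_true_iff; split; apply Nat.ltb_lt; lia. }
    exists (i :: w). simpl. rewrite Ea, Eb. rewrite <- Est. repeat split.
    + constructor; auto; lia.
    + destruct H as [<-|H]; [simpl; lia|apply Hp; auto].
    + destruct H as [<-|H]; [simpl; lia|apply Hp; auto].
    + intros x y Hxy. specialize (Hc x y Hxy).
      assert (nI := inv x y). unfold inverted, track in nI.
      assert (index x st <> index y st).
      { intros F. pose proof (proj2 (idx x ltac:(lia))). pose proof (proj2 (idx y ltac:(lia))).
        rewrite F in H. lia. }
      destruct (same_pair x y (a, b)) eqn:S.
      * apply same_pair_joins in S. simpl. rewrite Hc.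
        assert (x = a /\ y = b) as [-> ->].
        { destruct S as [S|S]; injection S; lia. }
        destruct (Nat.ltb_spec (index a st') (index b st')), (Nat.ltb_spec (index a st) (index b st));
          try lia; exfalso; rewrite (tr a), (tr b) in * by auto;
          rewrite !Nat.eqb_refl in *; destruct (Nat.eqb_spec b a); lia.
      * rewrite Hc.
        assert (nJ : ~ joins (a, b) x y) by (rewrite <- same_pair_joins, S; discriminate).
        destruct W' as [_ [_ mem']].
        assert (index x st' <> index y st').
        { intros F. pose proof (proj2 (index_spec x st' (proj2 (mem' x) ltac:(lia)))) as E1.
          pose proof (proj2 (index_spec y st' (proj2 (mem' y) ltac:(lia)))).
          rewrite F in E1. lia. }
        destruct (Nat.ltb_spec (index x st') (index y st')), (Nat.ltb_spec (index x st) (index y st));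
          auto; exfalso; apply nJ; destruct nI as [n1 n2]; try lia;
          destruct n1; try lia; auto.
    + constructor; auto. apply Forall_forall. intros q Hq x y z Jp Jq.
      specialize (Hp q Hq).
      assert (Hz : (x < m /\ z < m /\ x <> z)%nat).
      { destruct q as [q1 q2]; simpl in Hp. destruct Jq as [J|J]; injection J as -> ->; lia. }
      (* A pair that occurs later in the word is still uncrossed after the swap, by the counts. *)
      assert (nI : ~ inverted Z.of_nat (track st') x z).
      { intros Hinv.
        destruct (Nat.lt_ge_cases x z).
        - pose proof (Hc x z ltac:(lia)) as C. unfold inverted, track in Hinv.
          destruct (Nat.ltb_spec (index x st') (index z st')); [lia|].
          apply (filter_nil_joins _ _ _ C q Hq); auto.
        - pose proof (Hc z x ltac:(lia)) as C. unfold inverted, track in Hinv.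
          destruct (Nat.ltb_spec (index z st') (index x st')); [lia|].
          apply (filter_nil_joins _ _ _ C q Hq). destruct Jq; [right|left]; auto. }
      rewrite inv in nI by lia.
      assert (Hy : next_crossing m T Z.of_nat (track st) x y).
      { destruct Jp as [J|J]; injection J as <- <-; auto. }
      apply (next_crossing_lt m T Z.of_nat (track st) x y z); try tauto; try lia.
      intros <-. tauto.
Qed.

(** * Sorting, and the wiring diagram of a system of orders *)

Lemma sorted_insert (prec : nat -> nat -> Prop) x l :
  (forall y, In y l -> prec x y \/ prec y x) ->
  (forall y z, In y l -> In z l -> prec x y -> prec y z -> prec x z) ->
  StronglySorted prec l ->
  exists l', Permutation (x :: l) l' /\ StronglySorted prec l'.
Proof.
  induction l as [|y l IH]; intros tot tr srt.
  - exists (x :: nil); split; auto. repeat constructor.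
  - inversion srt as [|? ? srt' fa]; subst. rewrite Forall_forall in fa.
    destruct (tot y (or_introl eq_refl)) as [xy|yx].
    + exists (x :: y :: l); split; auto. constructor; auto.
      apply Forall_forall. intros z [<-|Hz]; auto. apply (tr y z); simpl; auto.
    + destruct IH as [l' [perm srt2]]; auto.
      { intros; apply tot; simpl; auto. }
      { intros a b ? ?; apply tr; simpl; auto. }
      exists (y :: l'); split.
      * rewrite perm_swap. constructor; auto.
      * constructor; auto. apply Forall_forall. intros z Hz.
        apply (Permutation_in _ (Permutation_sym perm)) in Hz.
        destruct Hz as [<-|Hz]; auto.
Qed.

Lemma strongly_sorted_nth (prec : nat -> nat -> Prop) l p q :
  StronglySorted prec l -> (p < q < length l)%nat -> prec (nth p l 0%nat) (nth q l 0%nat).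
Proof.
  revert p q; induction l as [|x l IH]; simpl; intros p q srt H; [lia|].
  inversion srt as [|? ? srt' fa]; subst. rewrite Forall_forall in fa.
  destruct q as [|q]; [lia|]. destruct p as [|p].
  - apply fa, nth_In; lia.
  - apply IH; auto; lia.
Qed.

(** Totality and transitivity are asked only on the list, because the order of the ends is
    meaningful only for indices below [m]. *)
Lemma sort_exists (prec : nat -> nat -> Prop) l :
  NoDup l ->
  (forall x y, In x l -> In y l -> x <> y -> prec x y \/ prec y x) ->
  (forall x y z, In x l -> In y l -> In z l -> prec x y -> prec y z -> prec x z) ->
  exists l', Permutation l l' /\ StronglySorted prec l'.
Proof.
  induction l as [|x l IH]; intros nd tot tr; [exists nil; split; constructor|].
  inversion nd; subst.
  destruct IH as [l' [perm srt]]; auto.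
  { intros; apply tot; simpl; auto. }
  { intros a b c ? ? ?; apply tr; simpl; auto. }
  assert (sub : forall y, In y l' -> In y l)
    by (intros y; apply Permutation_in, Permutation_sym, perm).
  destruct (sorted_insert prec x l') as [l2 [perm2 srt2]]; auto.
  { intros y Hy. apply tot; simpl; auto. intros ->; auto. }
  { intros y z Hy Hz; apply tr; simpl; auto. }
  exists l2; split; auto. rewrite perm. exact perm2.
Qed.

Lemma index_seq m x : (x < m)%nat -> index x (seq 0 m) = x.
Proof.
  intros Hx. transitivity (index (nth x (seq 0 m) 0%nat) (seq 0 m)).
  { rewrite seq_nth; auto. }
  apply index_nth; [apply seq_NoDup|rewrite length_seq; auto].
Qed.

Lemma wiring_of_orders m T :
  pseudoline_orders m T Z.of_nat ->
  exists w, is_wiring m w /\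
    (forall p, In p (crossing_pairs (seq 0 m) w) -> (fst p < snd p < m)%nat) /\
    chronological T (crossing_pairs (seq 0 m) w).
Proof.
  intros ord.
  destruct (sweep_complete m T ord
    (S (length (filter (uncrossed (seq 0 m)) (list_prod (seq 0 m) (seq 0 m))))) (seq 0 m))
    as [w [Hw [Hp [Hc Hch]]]].
  - split; [apply seq_NoDup|split; [apply length_seq|]]. intros x; rewrite in_seq; lia.
  - split; [intros; lia|split].
    + intros i j Hi Hj. unfold track. rewrite !index_seq by auto. lia.
    + intros i j k Hi Hj Hk ij ik. unfold inverted, track. rewrite !index_seq by auto. lia.
  - lia.
  - exists w; repeat split; auto; try apply Hp; auto.
    intros a b Hab. rewrite Hc by auto. rewrite !index_seq by lia.
    destruct (Nat.ltb_spec a b); auto; lia.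
Qed.

(** * Orienting the lines and ordering their ends *)

(* [T j k] is the parameter on line [j] of its crossing with [k], and [E i j] is the side of
   line [i] in which line [j] ends; the product compares the two ways of computing the side
   of line [i] that contains the crossing of [j] and [k]. *)
Definition consistent (m : nat) (T E : nat -> nat -> R) : Prop :=
  (forall i j k, (i < m)%nat -> (j < m)%nat -> (k < m)%nat ->
     i <> j -> i <> k -> j <> k -> T i j <> T i k) /\
  (forall i j, (i < m)%nat -> (j < m)%nat -> i <> j -> E i j = 1 \/ E i j = -1) /\
  (forall i j k, (i < m)%nat -> (j < m)%nat -> (k < m)%nat ->
     i <> j -> i <> k -> j <> k ->
     0 < E i j * (T j k - T j i) * (E i k * (T k j - T k i))).

Lemma pos_mult x y : 0 < x * y -> (0 < x /\ 0 < y) \/ (x < 0 /\ y < 0).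
Proof.
  intros H. destruct (Rtotal_order x 0) as [|[->|]], (Rtotal_order y 0) as [|[->|]]; try lra; nra.
Qed.

(** [d j] reverses line [j], which negates its parameters and moves its end to the other side of
    each line; [c i] renames the sides of line [i]. Every sign occurs twice in the product. *)
Lemma consistent_flip m T E c d :
  (forall i, c i = 1 \/ c i = -1) -> (forall i, d i = 1 \/ d i = -1) ->
  consistent m T E ->
  consistent m (fun j k => d j * T j k) (fun i j => c i * d j * E i j).
Proof.
  intros Hc Hd [dist [pm rel]]. split; [|split].
  - intros i j k Hi Hj Hk ij ik jk. pose proof (dist i j k Hi Hj Hk ij ik jk).
    destruct (Hd i) as [->| ->]; lra.
  - intros i j Hi Hj ij. destruct (Hc i) as [->| ->], (Hd j) as [->| ->],
      (pm i j Hi Hj ij) as [->| ->]; lra.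
  - intros i j k Hi Hj Hk ij ik jk. pose proof (rel i j k Hi Hj Hk ij ik jk).
    destruct (Hc i) as [->| ->], (Hd j) as [->| ->], (Hd k) as [->| ->]; lra.
Qed.

(** If [E i j = E j i], the relations seen from [i] and from [j] in the triple 0, [i], [j] multiply
    to the opposite of what the relation seen from 0 says. *)
Lemma consistent_antisym m T E :
  consistent m T E ->
  (forall j, (0 < j < m)%nat -> E 0%nat j = -1 /\ E j 0%nat = 1) ->
  forall i j, (i < m)%nat -> (j < m)%nat -> i <> j -> E i j = - E j i.
Proof.
  intros [dist [pm rel]] zero i j Hi Hj ij.
  destruct (Nat.eq_dec i 0) as [->|i0]; [destruct (zero j); [lia|lra]|].
  destruct (Nat.eq_dec j 0) as [->|j0]; [destruct (zero i); [lia|lra]|].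
  assert (H0 : (0 < m)%nat) by lia.
  pose proof (pos_mult _ _ (rel 0%nat i j H0 Hi Hj (not_eq_sym i0) (not_eq_sym j0) ij)) as R0.
  pose proof (pos_mult _ _ (rel i 0%nat j Hi H0 Hj i0 ij (not_eq_sym j0))) as R1.
  pose proof (pos_mult _ _ (rel j 0%nat i Hj H0 Hi j0 (not_eq_sym ij) (not_eq_sym i0))) as R2.
  destruct (zero i) as [zi zi']; [lia|]. destruct (zero j) as [zj zj']; [lia|].
  rewrite zi, zj in R0. rewrite zi' in R1. rewrite zj' in R2.
  destruct (pm i j Hi Hj ij) as [Eij|Eij], (pm j i Hj Hi (not_eq_sym ij)) as [Eji|Eji];
    rewrite Eij in *; rewrite Eji in *; try lra.
Qed.

Lemma consistent_trans m T E :
  consistent m T E ->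
  (forall j, (0 < j < m)%nat -> E 0%nat j = -1 /\ E j 0%nat = 1) ->
  forall i j k, (i < m)%nat -> (j < m)%nat -> (k < m)%nat ->
    i <> j -> j <> k -> i <> k -> E i j = -1 -> E j k = -1 -> E i k = -1.
Proof.
  intros con zero i j k Hi Hj Hk ij jk ik Eij Ejk.
  pose proof (consistent_antisym m T E con zero) as anti.
  destruct con as [dist [pm rel]].
  destruct (pm i k Hi Hk ik) as [Eik|]; [exfalso|assumption].
  assert (Eji : E j i = 1) by (rewrite anti; auto; lra).
  assert (Ekj : E k j = 1) by (rewrite anti; auto; lra).
  assert (Eki : E k i = -1) by (rewrite anti; auto; lra).
  destruct (Nat.eq_dec i 0) as [->|i0]; [destruct (zero k); [lia|lra]|].
  destruct (Nat.eq_dec j 0) as [->|j0]; [destruct (zero i); [lia|lra]|].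
  destruct (Nat.eq_dec k 0) as [->|k0]; [destruct (zero j); [lia|lra]|].
  assert (H0 : (0 < m)%nat) by lia.
  destruct (zero i) as [zi zi']; [lia|]. destruct (zero j) as [zj zj']; [lia|].
  destruct (zero k) as [zk zk']; [lia|].
  pose proof (pos_mult _ _ (rel i j k Hi Hj Hk ij ik jk)) as R1.
  pose proof (pos_mult _ _ (rel j k i Hj Hk Hi jk (not_eq_sym ij) (not_eq_sym ik))) as R2.
  pose proof (pos_mult _ _ (rel k i j Hk Hi Hj (not_eq_sym ik) (not_eq_sym jk) ij)) as R3.
  pose proof (pos_mult _ _ (rel 0%nat i j H0 Hi Hj (not_eq_sym i0) (not_eq_sym j0) ij)) as Q1.
  pose proof (pos_mult _ _ (rel 0%nat j k H0 Hj Hk (not_eq_sym j0) (not_eq_sym k0) jk)) as Q2.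
  pose proof (pos_mult _ _ (rel 0%nat i k H0 Hi Hk (not_eq_sym i0) (not_eq_sym k0) ik)) as Q3.
  pose proof (pos_mult _ _ (rel i 0%nat j Hi H0 Hj i0 ij (not_eq_sym j0))) as P1.
  pose proof (pos_mult _ _ (rel j 0%nat k Hj H0 Hk j0 jk (not_eq_sym k0))) as P2.
  pose proof (pos_mult _ _ (rel k 0%nat i Hk H0 Hi k0 (not_eq_sym ik) (not_eq_sym i0))) as P3.
  rewrite ?Eij, ?Ejk, ?Eki, ?Eik, ?Eji, ?Ekj, ?zi, ?zj, ?zk, ?zi', ?zj', ?zk' in *.
  clear dist pm rel zero anti.
  destruct R1, R2; try lra; destruct R3; try lra; destruct Q1; try lra;
    destruct Q2; try lra; destruct Q3; try lra; destruct P1; try lra;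
    destruct P2; try lra; destruct P3; lra.
Qed.

(* Line 0 is turned into the bottom line at the left end: it is kept as it is, every other line
   [j] is reversed if necessary so as to end below line 0, and its sides are named so
   that line 0 ends above [j]. *)
Lemma wiring_of_consistent m T E :
  (0 < m)%nat -> consistent m T E ->
  exists st d w, wires m st /\ (forall i, d i = 1 \/ d i = -1) /\ is_wiring m w /\
    (forall p, In p (crossing_pairs (seq 0 m) w) -> (fst p < snd p < m)%nat) /\
    chronological (fun a b => d (nth a st 0%nat) * T (nth a st 0%nat) (nth b st 0%nat))
      (crossing_pairs (seq 0 m) w).
Proof.
  intros m0 con.
  set (d := fun j => if (0 <? j)%nat && (j <? m)%nat then - E 0%nat j else 1).
  set (c := fun j => if (0 <? j)%nat && (j <? m)%nat then E j 0%nat else 1).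
  pose proof con as [_ [pm _]].
  assert (Hd : forall i, d i = 1 \/ d i = -1).
  { intros i; unfold d. destruct (Nat.ltb_spec 0 i), (Nat.ltb_spec i m); simpl; auto.
    destruct (pm 0%nat i) as [->| ->]; auto; try lia; lra. }
  assert (Hc : forall i, c i = 1 \/ c i = -1).
  { intros i; unfold c. destruct (Nat.ltb_spec 0 i), (Nat.ltb_spec i m); simpl; auto.
    apply pm; auto; lia. }
  pose proof (consistent_flip m T E c d Hc Hd con) as con'.
  set (T' := fun j k => d j * T j k) in con'.
  set (E' := fun i j => c i * d j * E i j) in con'.
  assert (zero : forall j, (0 < j < m)%nat -> E' 0%nat j = -1 /\ E' j 0%nat = 1).
  { intros j Hj. unfold E', c, d.
    destruct (Nat.ltb_spec 0 j), (Nat.ltb_spec j m), (Nat.ltb_spec 0 0); simpl; try lia.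
    destruct (pm 0%nat j ltac:(lia) ltac:(lia) ltac:(lia)) as [->| ->],
      (pm j 0%nat ltac:(lia) ltac:(lia) ltac:(lia)) as [->| ->]; lra. }
  pose proof (consistent_antisym m T' E' con' zero) as anti.
  pose proof (consistent_trans m T' E' con' zero) as trans.
  destruct con' as [dist [pm' rel]].
  clearbody E'. clear con pm Hc c.
  (* [i] precedes [j] when [j] ends below [i]: the list goes from top to bottom at the right end,
     hence from bottom to top at the left end. *)
  destruct (sort_exists (fun i j => i <> j /\ E' i j = -1) (seq 0 m)) as [st [perm srt]].
  - apply seq_NoDup.
  - intros x y Hx Hy xy. apply in_seq in Hx, Hy.
    destruct (pm' x y) as [Exy|Exy]; auto; try lia.
    right; split; auto. rewrite anti; auto; try lia; lra.
  - intros x y z Hx Hy Hz [xy Exy] [yz Eyz]. apply in_seq in Hx, Hy, Hz.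
    assert (xz : x <> z).
    { intros <-. rewrite anti in Exy; auto; try lia; lra. }
    split; auto. apply (trans x y z); auto; lia.
  - assert (W : wires m st).
    { split; [|split].
      - apply (Permutation_NoDup perm), seq_NoDup.
      - rewrite <- (Permutation_length perm). apply length_seq.
      - intros x. split; intros Hx.
        + apply (Permutation_in _ (Permutation_sym perm)), in_seq in Hx. lia.
        + apply (Permutation_in _ perm), in_seq. lia. }
    pose proof W as [nd [len mem]].
    pose proof (fun p q H => strongly_sorted_nth _ st p q srt H) as sgn. cbv beta in sgn.
    rewrite len in sgn.
    assert (lt : forall i, (i < m)%nat -> (nth i st 0 < m)%nat).
    { intros i Hi. apply mem, nth_In; lia. }
    assert (ne : forall i j, (i < m)%nat -> (j < m)%nat -> i <> j -> nth i st 0%nat <> nth j st 0%nat).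
    { intros i j Hi Hj ij F. apply ij. apply (proj1 (NoDup_nth st 0%nat) nd); auto; lia. }
    destruct (wiring_of_orders m (fun a b => T' (nth a st 0%nat) (nth b st 0%nat))) as [w [Hw [Hp Hch]]].
    + split.
      * intros i j k Hi Hj Hk ij ik jk. apply dist; auto.
      * intros i j k Hi Hj Hk Hlt.
        destruct (sgn i j) as [nij Eij]; [lia|]. destruct (sgn i k) as [nik Eik]; [lia|].
        destruct (sgn j k) as [njk Ejk]; [lia|].
        pose proof (lt i Hi) as Li. pose proof (lt j Hj) as Lj. pose proof (lt k Hk) as Lk.
        set (x := nth i st 0%nat) in *. set (y := nth j st 0%nat) in *.
        set (z := nth k st 0%nat) in *.
        assert (Eji : E' y x = 1) by (rewrite anti; auto; lra).
        assert (Ekj : E' z y = 1) by (rewrite anti; auto; lra).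
        assert (Eki : E' z x = 1) by (rewrite anti; auto; lra).
        (* With all six signs known, the relations seen from the three lines are the equivalences of
           the signotope condition. *)
        pose proof (pos_mult _ _ (rel x y z Li Lj Lk nij nik njk)) as R1.
        pose proof (pos_mult _ _ (rel y x z Lj Li Lk (not_eq_sym nij) njk nik)) as R2.
        pose proof (pos_mult _ _ (rel z x y Lk Li Lj (not_eq_sym nik) (not_eq_sym njk) nij)) as R3.
        rewrite Eij, Eik, Ejk, Eji, Ekj, Eki in *.
        split; split; lra.
    + exists st, d, w. split; [|split; [|split; [|split]]]; auto.
Qed.

(** * Pseudolines in the plane *)

Lemma dist2_fst p q : Rabs (fst p - fst q) <= dist2 p q.
Proof.
  unfold dist2. rewrite <- sqrt_Rsqr_abs. apply sqrt_le_1_alt. unfold Rsqr.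
  pose proof (pow2_ge_0 (snd p - snd q)). lra.
Qed.

Lemma dist2_snd p q : Rabs (snd p - snd q) <= dist2 p q.
Proof.
  unfold dist2. rewrite <- sqrt_Rsqr_abs. apply sqrt_le_1_alt. unfold Rsqr.
  pose proof (pow2_ge_0 (fst p - fst q)). lra.
Qed.

Lemma dist2_le p q : dist2 p q <= Rabs (fst p - fst q) + Rabs (snd p - snd q).
Proof.
  unfold dist2. pose proof (Rabs_pos (fst p - fst q)). pose proof (Rabs_pos (snd p - snd q)).
  rewrite <- (sqrt_Rsqr (Rabs (fst p - fst q) + Rabs (snd p - snd q))) by lra.
  apply sqrt_le_1_alt. rewrite <- (pow2_abs (fst p - fst q)), <- (pow2_abs (snd p - snd q)).
  unfold Rsqr. nra.
Qed.

Lemma unit_disk_iff y : unit_disk y <-> fst y ^ 2 + snd y ^ 2 < 1.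
Proof.
  unfold unit_disk, dist2; simpl fst; simpl snd. rewrite !Rminus_0_r. split; intros H.
  - rewrite <- sqrt_1 in H. apply sqrt_lt_0_alt in H. lra.
  - rewrite <- sqrt_1. apply sqrt_lt_1_alt. nra.
Qed.

Definition seg (a b : R2) (s : R) : R2 :=
  (fst a + s * (fst b - fst a), snd a + s * (snd b - snd a)).

Definition rcont_on (A : R2 -> Prop) (f : R2 -> R) : Prop :=
  forall x, A x -> forall eps, eps > 0 ->
    exists d, d > 0 /\ forall y, A y -> dist2 y x < d -> Rabs (f y - f x) < eps.

Lemma seg_zero A f a b :
  rcont_on A f -> (forall s, 0 <= s <= 1 -> A (seg a b s)) -> f a < 0 -> 0 < f b ->
  exists s, 0 <= s <= 1 /\ f (seg a b s) = 0.
Proof.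
  intros cf HA fa fb.
  (* Clamping to [0,1] extends the function to all reals, as [IVT] wants continuity everywhere. *)
  set (cl := fun s => Rmax 0 (Rmin 1 s)).
  assert (cl01 : forall s, 0 <= cl s <= 1).
  { intros s; unfold cl, Rmax, Rmin. destruct (Rle_dec 1 s); destruct (Rle_dec 0 _); lra. }
  assert (clid : forall s, 0 <= s <= 1 -> cl s = s).
  { intros s Hs; unfold cl, Rmax, Rmin. destruct (Rle_dec 1 s); destruct (Rle_dec 0 _); lra. }
  assert (cllip : forall s t, Rabs (cl s - cl t) <= Rabs (s - t)).
  { intros s t; unfold cl, Rmax, Rmin.
    destruct (Rle_dec 1 s), (Rle_dec 1 t); repeat destruct (Rle_dec 0 _);
      unfold Rabs; repeat destruct (Rcase_abs _); lra. }
  set (F := fun s => f (seg a b (cl s))).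
  assert (cF : continuity F).
  { intros s eps Heps. destruct (cf (seg a b (cl s)) (HA _ (cl01 s)) eps Heps) as [d [Hd Hf]].
    set (K := Rabs (fst b - fst a) + Rabs (snd b - snd a) + 1).
    assert (HK : 0 < K).
    { unfold K. pose proof (Rabs_pos (fst b - fst a)). pose proof (Rabs_pos (snd b - snd a)). lra. }
    exists (d / K). split; [apply Rdiv_lt_0_compat; lra|].
    intros t [_ Ht]. simpl in Ht. unfold Rdist in *. simpl. unfold Rdist.
    apply Hf; [apply HA, cl01|].
    apply Rle_lt_trans with (Rabs (cl t - cl s) * (K - 1)).
    - eapply Rle_trans; [apply dist2_le|]. unfold seg; simpl.
      replace (fst a + cl t * (fst b - fst a) - (fst a + cl s * (fst b - fst a)))
        with ((cl t - cl s) * (fst b - fst a)) by ring.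
      replace (snd a + cl t * (snd b - snd a) - (snd a + cl s * (snd b - snd a)))
        with ((cl t - cl s) * (snd b - snd a)) by ring.
      rewrite !Rabs_mult. unfold K. lra.
    - pose proof (cllip t s). pose proof (Rabs_pos (cl t - cl s)).
      assert (Rabs (t - s) * K < d) by (apply (Rmult_lt_compat_r K) in Ht; auto;
        replace (d / K * K) with d in Ht by (field; lra); auto).
      assert (0 <= K - 1) by (unfold K; pose proof (Rabs_pos (fst b - fst a));
        pose proof (Rabs_pos (snd b - snd a)); lra).
      apply Rle_lt_trans with (Rabs (t - s) * K); auto. apply Rmult_le_compat; lra. }
  assert (seg0 : seg a b 0 = a) by (destruct a; unfold seg; simpl; f_equal; ring).
  assert (seg1 : seg a b 1 = b) by (destruct b; unfold seg; simpl; f_equal; ring).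
  destruct (IVT F 0 1 cF) as [s [Hs Es]]; [lra| | |].
  - unfold F. rewrite clid, seg0 by lra. auto.
  - unfold F. rewrite clid, seg1 by lra. auto.
  - exists s; split; auto. unfold F in Es. rewrite clid in Es by lra. auto.
Qed.

Lemma seg_zero_opposite A f a b :
  rcont_on A f -> (forall s, 0 <= s <= 1 -> A (seg a b s)) -> f a * f b < 0 ->
  exists s, 0 <= s <= 1 /\ f (seg a b s) = 0.
Proof.
  intros cf HA H. destruct (Rlt_le_dec (f a) 0).
  - apply (seg_zero A); auto. nra.
  - assert (f a <> 0) by (intros F; rewrite F in H; lra).
    destruct (seg_zero A (fun x => - f x) a b) as [s [Hs Es]]; auto.
    + intros x Hx eps Heps. destruct (cf x Hx eps Heps) as [d [Hd Hf]].
      exists d; split; auto. intros y Hy Hxy.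
      replace (- f y - - f x) with (- (f y - f x)) by ring. rewrite Rabs_Ropp. auto.
    + nra.
    + nra.
    + exists s; split; auto. lra.
Qed.

Lemma cont_on_comp A B f g :
  cont_on A f -> cont_on B g -> (forall x, A x -> B (f x)) -> cont_on A (fun x => g (f x)).
Proof.
  intros cf cg AB x Hx eps Heps.
  destruct (cg (f x) (AB x Hx) eps Heps) as [d [Hd Hg]].
  destruct (cf x Hx d Hd) as [e [He Hf]].
  exists e; split; auto.
Qed.

Lemma rcont_on_fst A f c : cont_on A f -> rcont_on A (fun x => fst (f x) - c).
Proof.
  intros cf x Hx eps Heps. destruct (cf x Hx eps Heps) as [d [Hd Hf]].
  exists d; split; auto. intros y Hy Hxy.
  replace (fst (f y) - c - (fst (f x) - c)) with (fst (f y) - fst (f x)) by ring.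
  eapply Rle_lt_trans; [apply dist2_fst|auto].
Qed.

Lemma rcont_on_snd A f : cont_on A f -> rcont_on A (fun x => snd (f x)).
Proof.
  intros cf x Hx eps Heps. destruct (cf x Hx eps Heps) as [d [Hd Hf]].
  exists d; split; auto. intros y Hy Hxy.
  eapply Rle_lt_trans; [apply dist2_snd|auto].
Qed.

Definition inverse_homeos (h g : R2 -> R2) : Prop :=
  (forall x, g (h x) = x) /\ (forall y, h (g y) = y) /\
  cont_on (fun _ => True) h /\ cont_on (fun _ => True) g.

Definition axis_image (P : R2 -> Prop) (h : R2 -> R2) : Prop :=
  forall q, P q <-> exists t, q = h (t, 0).

Lemma axis_image_snd P h g q : inverse_homeos h g -> axis_image P h -> (P q <-> snd (g q) = 0).
Proof.
  intros [gh [hg _]] HP. rewrite (HP q). split.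
  - intros [t ->]. rewrite gh. auto.
  - intros E. exists (fst (g q)). rewrite <- E, <- surjective_pairing. auto.
Qed.

(** An open half disk is convex and its image avoids [P], so the global side function has no zero
    along the segment between the two points. *)
Lemma half_disk_same_side P h g U phi psi y1 y2 :
  inverse_homeos h g -> axis_image P h ->
  (forall y, unit_disk y -> U (psi y) /\ phi (psi y) = y) ->
  cont_on unit_disk psi ->
  (forall x, U x -> (P x <-> snd (phi x) = 0)) ->
  unit_disk y1 -> unit_disk y2 -> 0 < snd y1 * snd y2 ->
  0 < snd (g (psi y1)) * snd (g (psi y2)).
Proof.
  intros hg HP Hpsi cpsi HU D1 D2 Hs.
  assert (nz : forall y, unit_disk y -> snd y <> 0 -> snd (g (psi y)) <> 0).
  { intros y Dy ny E. apply (axis_image_snd P h g _ hg HP) in E.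
    destruct (Hpsi y Dy) as [Uy Ey]. apply HU in E; auto. congruence. }
  assert (n1 : snd (g (psi y1)) <> 0) by (apply nz; auto; nra).
  assert (n2 : snd (g (psi y2)) <> 0) by (apply nz; auto; nra).
  destruct (Rlt_le_dec 0 (snd (g (psi y1)) * snd (g (psi y2)))) as [|le]; [assumption|exfalso].
  assert (DS : forall s, 0 <= s <= 1 -> unit_disk (seg y1 y2 s)).
  { intros s Hs'. apply unit_disk_iff. apply unit_disk_iff in D1, D2. unfold seg; simpl fst; simpl snd.
    assert (conv : forall u v, (u + s * (v - u)) ^ 2 <= (1 - s) * u ^ 2 + s * v ^ 2).
    { intros u v. assert (0 <= s * (1 - s) * (u - v) ^ 2); [|lra].
      apply Rmult_le_pos; [apply Rmult_le_pos; lra|apply pow2_ge_0]. }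
    pose proof (conv (fst y1) (fst y2)). pose proof (conv (snd y1) (snd y2)).
    destruct (Req_dec s 0) as [->|s0]; [lra|].
    assert (0 < s * (1 - (fst y2 ^ 2 + snd y2 ^ 2))) by (apply Rmult_lt_0_compat; lra).
    assert (0 <= (1 - s) * (1 - (fst y1 ^ 2 + snd y1 ^ 2))) by (apply Rmult_le_pos; lra).
    lra. }
  destruct (seg_zero_opposite unit_disk (fun y => snd (g (psi y))) y1 y2) as [s [Hs' Es]]; auto.
  - apply (rcont_on_snd unit_disk (fun y => g (psi y))).
    apply (cont_on_comp unit_disk (fun _ => True)); auto. apply hg.
  - simpl. destruct (Rle_lt_or_eq_dec _ _ le) as [|E]; auto.
    apply Rmult_integral in E. tauto.
  - apply (nz (seg y1 y2 s)); auto. unfold seg; simpl. intros E.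
    destruct (Req_dec s 0) as [->|s0]; [destruct (pos_mult _ _ Hs); lra|].
    destruct (pos_mult _ _ Hs) as [[? ?]|[? ?]]; nra.
Qed.

(** This links the local chart to the global sides: each half of the disk lies on one side of [P],
    the two halves on different sides, and the vertical axis, which is [Q], enters both. *)
Lemma crossing_both_sides P Q p h g :
  inverse_homeos h g -> axis_image P h -> is_crossing P Q p ->
  exists q1 q2, Q q1 /\ Q q2 /\ 0 < snd (g q1) /\ snd (g q2) < 0.
Proof.
  intros hg HP [Pp [_ [U [phi [psi [oU [Up [_ [Hphi [Hpsi [_ [cpsi [UP UQ]]]]]]]]]]]]].
  pose proof hg as [gh [hgK [ch _]]].
  pose proof (fun y1 y2 => half_disk_same_side P h g U phi psi y1 y2 hg HP Hpsi cpsi UP) as same.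
  destruct (oU p Up) as [r [Hr ball]].
  apply HP in Pp. destruct Pp as [t0 ->].
  destruct (ch (t0, 0) I r Hr) as [d [Hd near]].
  (* Moving off the axis of [h] by [d / 2] gives points on the two sides of [P] that are still
     inside the chart. *)
  assert (inU : forall e, Rabs e = d / 2 -> U (h (t0, e))).
  { intros e He. apply ball, near; auto. eapply Rle_lt_trans; [apply dist2_le|]. simpl.
    rewrite Rminus_diag, Rminus_0_r, Rabs_R0, He. lra. }
  assert (Uup : U (h (t0, d / 2))) by (apply inU; rewrite Rabs_right; lra).
  assert (Udn : U (h (t0, - (d / 2)))) by (apply inU; rewrite Rabs_Ropp, Rabs_right; lra).
  destruct (Hphi _ Uup) as [Dup Eup]. destruct (Hphi _ Udn) as [Ddn Edn].
  set (yu := phi (h (t0, d / 2))) in *. set (yd := phi (h (t0, - (d / 2)))) in *.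
  assert (Su : snd (g (psi yu)) = d / 2) by (rewrite Eup, gh; auto).
  assert (Sd : snd (g (psi yd)) = - (d / 2)) by (rewrite Edn, gh; auto).
  assert (nu : snd yu <> 0).
  { intros E. apply UP in E; auto. apply (axis_image_snd P h g _ hg HP) in E.
    rewrite gh in E; simpl in E; lra. }
  assert (ndn : snd yd <> 0).
  { intros E. apply UP in E; auto. apply (axis_image_snd P h g _ hg HP) in E.
    rewrite gh in E; simpl in E; lra. }
  assert (opp : snd yu * snd yd < 0).
  { destruct (Rlt_le_dec 0 (snd yu * snd yd)) as [H|[|E]]; auto.
    - pose proof (same yu yd Dup Ddn H). nra.
    - apply Rmult_integral in E; tauto. }
  assert (onQ : forall e, Rabs e = 1 / 2 -> unit_disk (0, e) /\ Q (psi (0, e))).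
  { intros e He. assert (De : unit_disk (0, e)).
    { apply unit_disk_iff; simpl fst; simpl snd. rewrite <- (pow2_abs e), He. lra. }
    split; auto. destruct (Hpsi _ De) as [Ue Ee]. apply UQ; auto. rewrite Ee; auto. }
  destruct (onQ (1 / 2)) as [D1 Q1]; [rewrite Rabs_right; lra|].
  destruct (onQ (- (1 / 2))) as [D2 Q2]; [rewrite Rabs_Ropp, Rabs_right; lra|].
  destruct (Rlt_le_dec 0 (snd yu)).
  - exists (psi (0, 1 / 2)), (psi (0, - (1 / 2))). repeat split; auto.
    + pose proof (same yu (0, 1 / 2) Dup D1 ltac:(simpl; nra)). nra.
    + pose proof (same yd (0, - (1 / 2)) Ddn D2 ltac:(simpl; nra)). nra.
  - exists (psi (0, - (1 / 2))), (psi (0, 1 / 2)). repeat split; auto.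
    + pose proof (same yu (0, - (1 / 2)) Dup D2 ltac:(simpl; nra)). nra.
    + pose proof (same yd (0, 1 / 2) Ddn D1 ltac:(simpl; nra)). nra.
Qed.

(** The side function along [Q] vanishes only at [t], so its sign is constant before and after [t];
    both signs occur by [crossing_both_sides], so they differ. *)
Lemma crossing_switches_sides P Q p h g h' g' t :
  inverse_homeos h g -> axis_image P h -> inverse_homeos h' g' -> axis_image Q h' ->
  is_crossing P Q p -> (forall q, P q /\ Q q <-> q = p) -> h' (t, 0) = p ->
  exists E, (E = 1 \/ E = -1) /\
    forall s, s <> t -> 0 < E * (s - t) * snd (g (h' (s, 0))).
Proof.
  intros hg HP hg' HQ cr uniq Et.
  set (F := fun s => snd (g (h' (s, 0)))).
  assert (F0 : forall s, F s = 0 -> s = t).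
  { intros s Hs. apply (axis_image_snd P h g _ hg HP) in Hs.
    assert (E : h' (s, 0) = p) by (apply uniq; split; auto; apply HQ; eauto).
    rewrite <- Et in E. apply (f_equal g') in E. destruct hg' as [gh' _].
    rewrite !gh' in E. congruence. }
  assert (Ft : F t = 0).
  { apply (axis_image_snd P h g _ hg HP). rewrite Et. apply uniq; auto. }
  assert (side : forall a b, 0 < (a - t) * (b - t) -> 0 < F a * F b).
  { intros a b Hab.
    destruct (Rlt_le_dec 0 (F a * F b)) as [|le]; [assumption|exfalso].
    destruct le as [lt|E].
    - destruct (seg_zero_opposite (fun _ => True) (fun q => snd (g (h' q))) (a, 0) (b, 0))
        as [s [Hs Es]]; auto.
      + apply (rcont_on_snd _ (fun q => g (h' q))).
        apply (cont_on_comp _ (fun _ => True)); auto; [apply hg'|apply hg].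
      + unfold seg in Es; simpl in Es. replace (0 + s * (0 - 0)) with 0 in Es by ring.
        apply F0 in Es.
        destruct (Req_dec s 0) as [->|s0]; [destruct (pos_mult _ _ Hab); lra|].
        destruct (pos_mult _ _ Hab) as [[? ?]|[? ?]]; nra.
    - apply Rmult_integral in E. destruct E as [E|E]; apply F0 in E; subst; lra. }
  destruct (crossing_both_sides P Q p h g hg HP cr) as [q1 [q2 [Q1 [Q2 [S1 S2]]]]].
  apply HQ in Q1, Q2. destruct Q1 as [t1 ->], Q2 as [t2 ->].
  change (0 < F t1) in S1. change (F t2 < 0) in S2.
  assert (t1 <> t) by (intros ->; lra). assert (t2 <> t) by (intros ->; lra).
  exists (if Rlt_dec t t1 then 1 else -1). split; [destruct (Rlt_dec t t1); auto|].
  intros s Hs. change (snd (g (h' (s, 0)))) with (F s).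
  pose proof (side s t1) as A1. pose proof (side s t2) as A2. pose proof (side t1 t2) as A12.
  destruct (Rlt_dec t t1), (Rlt_dec t t2), (Rlt_dec t s); try (exfalso; nra);
    repeat match goal with H : 0 < (?a - t) * (?b - t) -> _ |- _ =>
      destruct (Rlt_dec 0 ((a - t) * (b - t))) as [?l|?l]; [specialize (H l)|clear H] end;
    nra.
Qed.

Lemma param_of_inverse P h : param_of P h -> exists g, inverse_homeos h g /\ axis_image P h.
Proof. intros [[g Hg] HP]. exists g. split; auto. Qed.

(** [pa_edge] lets any parametrization of the line witness an edge, while the crossing orders come
    from fixed ones. *)
Lemma param_between P h1 h2 a b c a' b' :
  param_of P h1 -> param_of P h2 -> h2 (a', 0) = h1 (a, 0) -> h2 (b', 0) = h1 (b, 0) ->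
  0 < (c - a) * (b - c) ->
  exists c', h2 (c', 0) = h1 (c, 0) /\ Rmin a' b' < c' < Rmax a' b'.
Proof.
  intros P1 P2 Ea Eb Hc.
  destruct (param_of_inverse P h1 P1) as [g1 [I1 A1]].
  destruct (param_of_inverse P h2 P2) as [g2 [I2 A2]].
  pose proof I1 as [gh1 _].
  set (F := fun q => fst (g1 (h2 q)) - c).
  assert (Fa : F (a', 0) = a - c) by (unfold F; rewrite Ea, gh1; auto).
  assert (Fb : F (b', 0) = b - c) by (unfold F; rewrite Eb, gh1; auto).
  destruct (seg_zero_opposite (fun _ => True) F (a', 0) (b', 0)) as [s [Hs Es]]; auto.
  - apply (rcont_on_fst _ (fun q => g1 (h2 q))).
    apply (cont_on_comp _ (fun _ => True)); auto; [apply I2|apply I1].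
  - rewrite Fa, Fb. nra.
  - unfold seg in Es; simpl in Es. replace (0 + s * (0 - 0)) with 0 in Es by ring.
    set (c' := a' + s * (b' - a')) in *. exists c'. split.
    + assert (M : P (h2 (c', 0))) by (apply A2; eauto).
      apply A1 in M. destruct M as [t Et]. unfold F in Es. rewrite Et, gh1 in Es; simpl in Es.
      rewrite Et. f_equal. f_equal. lra.
    + assert (c' <> a') by (intros E; rewrite E in Es; nra).
      assert (c' <> b') by (intros E; rewrite E in Es; nra).
      unfold Rmin, Rmax. destruct (Rle_dec a' b'); unfold c' in *; nra.
Qed.

Lemma arrangement_consistent m L :
  simple_arrangement m L ->
  exists h T E, (forall i, (i < m)%nat -> param_of (L i) (h i)) /\ consistent m T E /\
    forall i j, (i < m)%nat -> (j < m)%nat -> i <> j -> L j (h i (T i j, 0)).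
Proof.
  intros [HL [Hcr Hsimple]].
  (* In all these choices the bounds are inside the chosen property, so indices outside the
     arrangement get arbitrary values. *)
  destruct (functional_choice (fun i h => (i < m)%nat -> param_of (L i) h)) as [h Hh].
  { intros i. destruct (Nat.lt_ge_cases i m) as [Hi|Hi].
    - destruct (HL i Hi) as [h Hh]. exists h; auto.
    - exists (fun x => x). lia. }
  destruct (functional_choice (fun i g => (i < m)%nat ->
    inverse_homeos (h i) g /\ axis_image (L i) (h i))) as [g Hg].
  { intros i. destruct (Nat.lt_ge_cases i m) as [Hi|Hi].
    - destruct (param_of_inverse _ _ (Hh i Hi)) as [g Hg]. exists g; auto.
    - exists (fun x => x). lia. }
  destruct (functional_choice (fun (ij : nat * nat) t =>
    (fst ij < m)%nat -> (snd ij < m)%nat -> fst ij <> snd ij ->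
    L (snd ij) (h (fst ij) (t, 0)))) as [T HT].
  { intros [i j]; simpl.
    destruct (Nat.lt_ge_cases i m) as [Hi|Hi]; [|exists 0; lia].
    destruct (Nat.lt_ge_cases j m) as [Hj|Hj]; [|exists 0; lia].
    destruct (Nat.eq_dec i j) as [->|ij]; [exists 0; lia|].
    destruct (Hcr i j Hi Hj ij) as [p [Hp _]].
    destruct (proj2 (Hp p) eq_refl) as [Lp Lp']. destruct (Hh i Hi) as [_ ax].
    apply ax in Lp. destruct Lp as [t ->]. exists t; auto. }
  assert (on : forall i t, (i < m)%nat -> L i (h i (t, 0))).
  { intros i t Hi. apply (Hh i Hi). eauto. }
  assert (HT' : forall i j, (i < m)%nat -> (j < m)%nat -> i <> j -> L j (h i (T (i, j), 0))).
  { intros i j. apply (HT (i, j)). }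
  assert (same : forall i j, (i < m)%nat -> (j < m)%nat -> i <> j ->
            h i (T (i, j), 0) = h j (T (j, i), 0)).
  { intros i j Hi Hj ij. destruct (Hcr i j Hi Hj ij) as [p [Hp _]].
    transitivity p; [|symmetry]; apply Hp; split; auto. }
  destruct (functional_choice (fun (ij : nat * nat) E =>
    (fst ij < m)%nat -> (snd ij < m)%nat -> fst ij <> snd ij ->
    (E = 1 \/ E = -1) /\ forall s, s <> T (snd ij, fst ij) ->
      0 < E * (s - T (snd ij, fst ij)) * snd (g (fst ij) (h (snd ij) (s, 0))))) as [E HE].
  { intros [i j]; simpl.
    destruct (Nat.lt_ge_cases i m) as [Hi|Hi]; [|exists 0; lia].
    destruct (Nat.lt_ge_cases j m) as [Hj|Hj]; [|exists 0; lia].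
    destruct (Nat.eq_dec i j) as [->|ij]; [exists 0; lia|].
    destruct (Hcr i j Hi Hj ij) as [p [Hp cr]].
    destruct (crossing_switches_sides (L i) (L j) p (h i) (g i) (h j) (g j) (T (j, i)))
      as [E HE]; try apply Hg; auto.
    - apply Hp; auto.
    - exists E; auto. }
  exists h, (fun i j => T (i, j)), (fun i j => E (i, j)).
  assert (dist : forall i j k, (i < m)%nat -> (j < m)%nat -> (k < m)%nat ->
     i <> j -> i <> k -> j <> k -> T (i, j) <> T (i, k)).
  { intros i j k Hi Hj Hk ij ik jk F.
    apply (Hsimple i j i k (h i (T (i, j), 0))); auto; [lia|].
    rewrite F. auto. }
  split; [exact Hh|split; [split; [exact dist|split]|exact HT']].
  - intros i j Hi Hj ij. apply (HE (i, j)); auto.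
  - intros i j k Hi Hj Hk ij ik jk.
    (* Both products describe the side of line [i] of one point, the crossing of [j] and [k],
       reached along [j] and along [k]; its coordinate [X] cancels from the signs. *)
    pose proof (proj2 (HE (i, j) Hi Hj ij) (T (j, k)) ltac:(simpl; auto)) as A.
    pose proof (proj2 (HE (i, k) Hi Hk ik) (T (k, j)) ltac:(simpl; auto)) as B.
    simpl in A, B. rewrite <- (same j k) in B by auto.
    set (X := snd (g i (h j (T (j, k), 0)))) in *.
    set (a := E (i, j) * (T (j, k) - T (j, i))) in *.
    set (b := E (i, k) * (T (k, j) - T (k, i))) in *.
    destruct (Rlt_le_dec 0 X); nra.
Qed.

(** * Drawing a wiring diagram level by level *)

(** Crossings are named by their times. Unit steps along a level keep lattice points out of the
    interior of horizontal edges; the rows are arbitrary apart from increasing. *)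
Definition layout (n : nat) (lev : nat -> nat) (x : nat -> Z) (row : nat -> Z) : Prop :=
  (forall s t, (s < t < n)%nat -> lev s = lev t -> (x s < x t)%Z) /\
  (forall s t, (s < t < n)%nat -> lev s = lev t ->
     (forall r, (s < r < t)%nat -> lev r <> lev s) -> x t = (x s + 1)%Z) /\
  (forall s t, (s < n)%nat -> (t < n)%nat -> (lev s < lev t)%nat ->
     (row (lev s) < row (lev t))%Z).

Definition place (lev : nat -> nat) (x row : nat -> Z) (t : nat) : Z * Z := (x t, row (lev t)).

Definition horizontal (n : nat) (lev : nat -> nat) (x : nat -> Z) (a b : nat) : Prop :=
  (a < n)%nat /\ (b < n)%nat /\ lev a = lev b /\ x b = (x a + 1)%Z.

Definition slanted (n : nat) (lev : nat -> nat) (a b : nat) : Prop :=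
  (a < n)%nat /\ (b < n)%nat /\ lev b = S (lev a) /\
  forall r, (a < r < b \/ b < r < a)%nat -> lev r <> lev a /\ lev r <> lev b.

Definition link n lev x a b : Prop := horizontal n lev x a b \/ slanted n lev a b.

Lemma on_seg_sym a b z : on_seg a b z -> on_seg b a z.
Proof.
  intros [t [Ht ->]]. exists (1 - t). split; [lra|]. f_equal; ring.
Qed.

Lemma place_inj n lev x row s t : layout n lev x row -> (s < n)%nat -> (t < n)%nat ->
  lev s = lev t -> x s = x t -> s = t.
Proof.
  intros [mono _] Hs Ht El Ex.
  destruct (Nat.lt_total s t) as [lt|[|lt]]; auto; exfalso.
  - specialize (mono s t ltac:(lia) El). lia.
  - specialize (mono t s ltac:(lia) (eq_sym El)). lia.
Qed.

Lemma row_inj n lev x row s t : layout n lev x row -> (s < n)%nat -> (t < n)%nat ->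
  row (lev s) = row (lev t) -> lev s = lev t.
Proof.
  intros [_ [_ mono]] Hs Ht E.
  destruct (Nat.lt_total (lev s) (lev t)) as [lt|[|lt]]; auto; exfalso.
  - specialize (mono s t Hs Ht lt). lia.
  - specialize (mono t s Ht Hs lt). lia.
Qed.

Lemma link_vertex n lev x row a b r : layout n lev x row -> link n lev x a b -> (r < n)%nat ->
  on_seg (ipt (place lev x row a)) (ipt (place lev x row b)) (ipt (place lev x row r)) ->
  r = a \/ r = b.
Proof.
  intros L K Hr [u [Hu E]]. unfold ipt, place in E; simpl in E.
  injection E as Ex Ey.
  destruct K as [[Ha [Hb [El Eb]]]|[Ha [Hb [El _]]]].
  - rewrite <- El, Rminus_diag, Rmult_0_r, Rplus_0_r in Ey. apply eq_IZR in Ey.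
    apply (row_inj n _ x) in Ey; auto. rewrite Eb, plus_IZR in Ex.
    assert (x a <= x r)%Z by (apply le_IZR; nra).
    assert (x r <= x a + 1)%Z by (apply le_IZR; rewrite plus_IZR; nra).
    destruct (Z.eq_dec (x r) (x a)).
    + left. apply (place_inj n lev x row); auto.
    + right. apply (place_inj n lev x row); auto; [congruence|lia].
  - assert (lt : (row (lev a) < row (lev b))%Z) by (apply L; auto; lia).
    apply IZR_lt in lt.
    (* No used row lies strictly between those of two consecutive levels. *)
    assert (H : lev r = lev a \/ lev r = lev b).
    { pose proof L as [_ [_ mono]].
      destruct (Nat.lt_ge_cases (lev r) (lev a)) as [l1|g1].
      - specialize (mono r a Hr Ha l1). apply IZR_lt in mono. nra.
      - destruct (Nat.lt_ge_cases (lev b) (lev r)) as [l2|g2].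
        + specialize (mono b r Hb Hr l2). apply IZR_lt in mono. nra.
        + lia. }
    destruct H as [H|H]; rewrite H in Ey.
    + left. assert (u = 0) by nra. subst u.
      apply (place_inj n lev x row); auto. apply eq_IZR. lra.
    + right. assert (u = 1) by nra. subst u.
      apply (place_inj n lev x row); auto. apply eq_IZR. lra.
Qed.

Definition meet_properly lev x row (z : R2) (a b a' b' : nat) : Prop :=
  (a = a' /\ b = b') \/
  exists w, (w = a \/ w = b) /\ (w = a' \/ w = b') /\ z = ipt (place lev x row w).

Lemma meet_at_end n lev x row a b a' b' w : layout n lev x row ->
  link n lev x a b -> (w = a' \/ w = b') -> (w < n)%nat ->
  on_seg (ipt (place lev x row a)) (ipt (place lev x row b)) (ipt (place lev x row w)) ->
  meet_properly lev x row (ipt (place lev x row w)) a b a' b'.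
Proof.
  intros L K Hw Hn S. right. exists w. split; [|auto].
  apply (link_vertex n lev x row); auto.
Qed.

Lemma meet_properly_sym lev x row z a b a' b' :
  meet_properly lev x row z a b a' b' -> meet_properly lev x row z a' b' a b.
Proof.
  intros [[-> ->]|[w [? [? ?]]]]; [left; auto|right; exists w; auto].
Qed.

Lemma slanted_ends n lev x row a b r z : layout n lev x row -> slanted n lev a b -> (r < n)%nat ->
  on_seg (ipt (place lev x row a)) (ipt (place lev x row b)) z -> snd z = IZR (row (lev r)) ->
  z = ipt (place lev x row a) \/ z = ipt (place lev x row b).
Proof.
  intros L [Ha [Hb [El _]]] Hr [u [Hu ->]]. unfold ipt, place; simpl. intros Ey.
  assert (lt : (row (lev a) < row (lev b))%Z) by (apply L; auto; lia).
  apply IZR_lt in lt.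
  assert (H : lev r = lev a \/ lev r = lev b).
  { pose proof L as [_ [_ mono]].
    destruct (Nat.lt_ge_cases (lev r) (lev a)) as [l1|g1].
    - specialize (mono r a Hr Ha l1). apply IZR_lt in mono. nra.
    - destruct (Nat.lt_ge_cases (lev b) (lev r)) as [l2|g2].
      + specialize (mono b r Hb Hr l2). apply IZR_lt in mono. nra.
      + lia. }
  destruct H as [H|H]; rewrite H in Ey.
  - left. assert (u = 0) by nra. subst u. f_equal; ring.
  - right. assert (u = 1) by nra. subst u. f_equal; ring.
Qed.

(* Slanted segments in one strip are totally ordered from left to right: in time, the
   crossings on the two bounding levels interlace so that neither segment ends inside the
   other. *)
Lemma slanted_same_strip n lev x row a b a' b' z : layout n lev x row ->
  slanted n lev a b -> slanted n lev a' b' -> lev a = lev a' ->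
  on_seg (ipt (place lev x row a)) (ipt (place lev x row b)) z ->
  on_seg (ipt (place lev x row a')) (ipt (place lev x row b')) z ->
  meet_properly lev x row z a b a' b'.
Proof.
  intros L [Ha [Hb [El Gap]]] [Ha' [Hb' [El' Gap']]] Eq [u [Hu Ez]] [v [Hv Ez']].
  assert (Eb : lev b = lev b') by lia.
  (* Both segments span the same two rows, so equal heights mean equal parameters. *)
  assert (lt : (row (lev a) < row (lev b))%Z) by (apply L; auto; lia).
  apply IZR_lt in lt.
  unfold ipt, place in Ez, Ez'; simpl in Ez, Ez'.
  rewrite Ez in Ez'. injection Ez' as Ex Ey.
  rewrite <- Eq, <- Eb in Ey.
  assert (v = u) by nra. subst v. clear Ey.
  assert (ord : (a <= a' /\ b <= b' \/ a' <= a /\ b' <= b)%nat).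
  { assert (a <> b /\ a' <> b' /\ a <> b' /\ b <> a')%nat as [? [? [? ?]]]
      by (repeat split; intros F; subst; lia).
    pose proof (Gap a'). pose proof (Gap b'). pose proof (Gap' a). pose proof (Gap' b). lia. }
  assert (mono : forall s t, (s < n)%nat -> (t < n)%nat -> lev s = lev t -> (s <= t)%nat ->
            s = t \/ IZR (x s) < IZR (x t)).
  { intros s t Hs Ht E le. destruct (Nat.eq_dec s t); [auto|right].
    apply IZR_lt, L; auto; lia. }
  (* At parameter [u] the abscissas are averages of those of the ends, with weights [1 - u] and [u];
     ends ordered the same way on both rows allow equality only at shared ends. *)
  assert (cases : (a = a' \/ u = 1) /\ (b = b' \/ u = 0)).
  { destruct ord as [[o1 o2]|[o1 o2]].
    - destruct (mono a a' Ha Ha' Eq o1), (mono b b' Hb Hb' Eb o2); subst; try (split; auto; fail).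
      + split; auto. right. nra.
      + split; auto. right. nra.
      + nra.
    - destruct (mono a' a Ha' Ha (eq_sym Eq) o1), (mono b' b Hb' Hb (eq_sym Eb) o2); subst;
        try (split; auto; fail).
      + split; auto. right. nra.
      + split; auto. right. nra.
      + nra. }
  destruct cases as [[Ca|Ca] [Cb|Cb]].
  - left; auto.
  - right; exists a; repeat split; auto. rewrite Ez, Cb. unfold ipt, place; simpl; f_equal; ring.
  - right; exists b; repeat split; auto. rewrite Ez, Ca. unfold ipt, place; simpl; f_equal; ring.
  - lra.
Qed.

(** Apart from two segments in one row or in one strip, a common point lies in the row of a vertex,
    and a slanted segment reaches such a row only at an end. *)
Lemma links_meet_properly n lev x row a b a' b' z : layout n lev x row ->
  link n lev x a b -> link n lev x a' b' ->
  on_seg (ipt (place lev x row a)) (ipt (place lev x row b)) z ->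
  on_seg (ipt (place lev x row a')) (ipt (place lev x row b')) z ->
  meet_properly lev x row z a b a' b'.
Proof.
  assert (mixed : forall a b a' b', layout n lev x row ->
    horizontal n lev x a b -> slanted n lev a' b' ->
    on_seg (ipt (place lev x row a)) (ipt (place lev x row b)) z ->
    on_seg (ipt (place lev x row a')) (ipt (place lev x row b')) z ->
    meet_properly lev x row z a b a' b').
  { clear. intros a b a' b' L H S Z Z'.
    assert (Ey : snd z = IZR (row (lev a))).
    { destruct Z as [u [_ ->]]. unfold ipt, place; simpl. destruct H as [_ [_ [-> _]]]. ring. }
    destruct (slanted_ends n lev x row a' b' a z L S) as [-> | ->]; auto; try apply H.
    - apply (meet_at_end n); auto; [left; auto|apply S].
    - apply (meet_at_end n); auto; [left; auto|apply S]. }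
  intros L K K' Z Z'.
  destruct K as [H|S], K' as [H'|S'].
  - pose proof Z as [u [Hu Ez]]. pose proof Z' as [v [Hv Ez']].
    pose proof H as [Ha [Hb [El Ex]]]. pose proof H' as [Ha' [Hb' [El' Ex']]].
    unfold ipt, place in Ez, Ez'; simpl in Ez, Ez'.
    assert (Eq : lev a = lev a').
    { rewrite Ez in Ez'. injection Ez' as _ Ey. rewrite <- El, <- El' in Ey.
      apply (row_inj n _ x row); auto. apply eq_IZR. lra. }
    rewrite Ex, plus_IZR in Ez. rewrite Ex', plus_IZR in Ez'.
    assert (E : IZR (x a) + u = IZR (x a') + v).
    { rewrite Ez in Ez'. injection Ez' as E _. lra. }
    assert (x a - 1 <= x a')%Z by (apply le_IZR; rewrite minus_IZR; lra).
    assert (x a' <= x a + 1)%Z by (apply le_IZR; rewrite plus_IZR; lra).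
    assert (c : (x a' = x a \/ x a' = x a + 1 \/ x a = x a' + 1)%Z) by lia.
    destruct c as [c|[c|c]].
    + assert (a = a') by (apply (place_inj n lev x row); auto).
      assert (b = b') by (apply (place_inj n lev x row); auto; try congruence; lia).
      left; auto.
    + assert (Eb : b = a') by (apply (place_inj n lev x row); auto; try congruence; lia).
      right; exists b; repeat split; auto.
      rewrite c, plus_IZR in E. rewrite Ez. unfold ipt, place; simpl.
      rewrite Ex, plus_IZR, <- El. f_equal; [lra|ring].
    + assert (Eb : b' = a) by (apply (place_inj n lev x row); auto; try congruence; lia).
      right; exists a; repeat split; auto.
      rewrite c, plus_IZR in E. rewrite Ez. unfold ipt, place; simpl.
      rewrite <- El. f_equal; [|ring]. assert (u = 0) by lra. subst u. ring.
  - apply mixed; auto.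
  - apply meet_properly_sym, mixed; auto.
  - destruct (Nat.eq_dec (lev a) (lev a')) as [Eq|ne].
    { apply (slanted_same_strip n); auto. }
    assert (wlog : forall a b a' b', slanted n lev a b -> slanted n lev a' b' ->
      (lev a < lev a')%nat ->
      on_seg (ipt (place lev x row a)) (ipt (place lev x row b)) z ->
      on_seg (ipt (place lev x row a')) (ipt (place lev x row b')) z ->
      meet_properly lev x row z a b a' b').
    { clear - L. intros a b a' b' S S' lt Z Z'.
      pose proof S as [Ha [Hb [El _]]]. pose proof S' as [Ha' [Hb' [El' _]]].
      pose proof L as [_ [_ mono]].
      assert (r1 : (row (lev b) <= row (lev a'))%Z).
      { destruct (Nat.eq_dec (lev b) (lev a')) as [->|]; [lia|].
        apply Z.lt_le_incl, mono; auto; lia. }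
      assert (r2 : (row (lev a) < row (lev b))%Z) by (apply mono; auto; lia).
      assert (r3 : (row (lev a') < row (lev b'))%Z) by (apply mono; auto; lia).
      apply IZR_le in r1. apply IZR_lt in r2, r3.
      (* Different strips share at most one row, and [z] has to lie in it. *)
      assert (Ey : snd z = IZR (row (lev a'))).
      { destruct Z as [u [Hu Ez]], Z' as [v [Hv Ez']].
        unfold ipt, place in Ez, Ez'; simpl in Ez, Ez'.
        assert (snd z <= IZR (row (lev b))) by (rewrite Ez; simpl; nra).
        assert (IZR (row (lev a')) <= snd z) by (rewrite Ez'; simpl; nra).
        lra. }
      destruct (slanted_ends n lev x row a b a' z L S Ha' Z Ey) as [-> | ->];
        apply meet_properly_sym, (meet_at_end n); auto; right; auto. }
    destruct (Nat.lt_ge_cases (lev a) (lev a')).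
    + apply wlog; auto.
    + apply meet_properly_sym, wlog; auto. lia.
Qed.

(** * Abscissas: ranks within a level *)

Definition rank (w : list nat) (t : nat) : nat :=
  count_occ Nat.eq_dec (firstn (S t) w) (nth t w 0%nat).

Lemma count_firstn_S w t v : (t < length w)%nat ->
  count_occ Nat.eq_dec (firstn (S t) w) v =
  (count_occ Nat.eq_dec (firstn t w) v + if Nat.eq_dec (nth t w 0) v then 1 else 0)%nat.
Proof.
  revert t; induction w as [|x w IH]; intros t Ht; simpl in Ht; [lia|].
  destruct t as [|t]; [simpl; destruct (Nat.eq_dec x v); auto|].
  rewrite (firstn_cons (S t)), firstn_cons. simpl. simpl in IH. rewrite IH by lia.
  destruct (Nat.eq_dec x v); lia.
Qed.

Lemma count_firstn_mono w s t v : (s <= t <= length w)%nat ->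
  (count_occ Nat.eq_dec (firstn s w) v <= count_occ Nat.eq_dec (firstn t w) v)%nat.
Proof.
  induction t as [|t IH]; intros H.
  - replace s with 0%nat by lia. auto.
  - destruct (Nat.eq_dec s (S t)) as [->|]; auto.
    rewrite count_firstn_S by lia. specialize (IH ltac:(lia)). lia.
Qed.

Lemma count_firstn_gap w s t v : (s <= t <= length w)%nat ->
  (forall r, (s <= r < t)%nat -> nth r w 0%nat <> v) ->
  count_occ Nat.eq_dec (firstn t w) v = count_occ Nat.eq_dec (firstn s w) v.
Proof.
  induction t as [|t IH]; intros H gap.
  - replace s with 0%nat by lia. auto.
  - destruct (Nat.eq_dec s (S t)) as [->|]; auto.
    rewrite count_firstn_S by lia. destruct (Nat.eq_dec (nth t w 0%nat) v) as [E|].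
    + exfalso; apply (gap t); auto; lia.
    + rewrite IH; [lia|lia|]. intros; apply gap; lia.
Qed.

(** [rank] counts the crossing itself, so it starts at 1, the least abscissa allowed. *)
Lemma rank_bounds w t : (t < length w)%nat ->
  (1 <= rank w t <= level_size w (nth t w 0%nat))%nat.
Proof.
  intros Ht. unfold rank, level_size. split.
  - rewrite count_firstn_S by auto. destruct (Nat.eq_dec _ _); [lia|congruence].
  - rewrite <- (firstn_all w) at 3. apply count_firstn_mono. lia.
Qed.

Lemma wiring_layout w row :
  (forall i j, In i w -> In j w -> (i < j)%nat -> (row i < row j)%Z) ->
  layout (length w) (fun t => nth t w 0%nat) (fun t => Z.of_nat (rank w t)) row.
Proof.
  intros mono. unfold rank. split; [|split].
  - intros s t Hst E. apply inj_lt. rewrite <- E, (count_firstn_S w t) by lia.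
    rewrite <- E. destruct (Nat.eq_dec _ _); [|congruence].
    pose proof (count_firstn_mono w (S s) t (nth s w 0%nat)). lia.
  - intros s t Hst E gap. rewrite <- E, (count_firstn_S w t) by lia.
    rewrite <- E. destruct (Nat.eq_dec _ _); [|congruence].
    rewrite (count_firstn_gap w (S s) t); [lia|lia|]. intros r Hr. apply gap; lia.
  - intros s t Hs Ht lt. apply mono; auto; apply nth_In; auto.
Qed.

(** * Choice of rows and the point set *)

Fixpoint sum_below (f : nat -> nat) (n : nat) : nat :=
  match n with 0%nat => 0%nat | S n' => (sum_below f n' + f n')%nat end.

Lemma sum_below_add f g n :
  sum_below (fun i => f i + g i)%nat n = (sum_below f n + sum_below g n)%nat.
Proof. induction n; simpl; lia. Qed.

Lemma sum_below_scale c f n : sum_below (fun i => c * f i)%nat n = (c * sum_below f n)%nat.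
Proof. induction n; simpl; lia. Qed.

Lemma sum_below_count w n : (sum_below (level_size w) n <= length w)%nat.
Proof.
  induction w as [|x w IH].
  - simpl. induction n; simpl; auto. lia.
  - assert (H : sum_below (level_size (x :: w)) n =
      (sum_below (level_size w) n + if x <? n then 1 else 0)%nat).
    { clear IH. induction n as [|n IH]; [auto|]. simpl sum_below. rewrite IH.
      unfold level_size at 2. simpl.
      destruct (Nat.ltb_spec x n), (Nat.ltb_spec x (S n)), (Nat.eq_dec x n);
        unfold level_size; lia. }
    rewrite H. simpl. destruct (x <? n); lia.
Qed.

(** The parameter [k] truncates the sum to exponents below [k]; this also keeps the value finite at
    [r = 0]. *)
Fixpoint ruler (k r : nat) : nat :=
  match k with
  | 0%nat => 0%nat
  | S k' => (ruler k' r + if r mod 2 ^ k' =? 0 then 2 ^ k' else 0)%nat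
  end.

Lemma ruler_ge k r t : (t < k)%nat -> (r mod 2 ^ t = 0)%nat -> (2 ^ t <= ruler k r)%nat.
Proof.
  induction k as [|k IH]; intros Ht Hr; [lia|]. simpl.
  destruct (Nat.eq_dec t k) as [->|]; [rewrite Hr; simpl; lia|].
  specialize (IH ltac:(lia) Hr). lia.
Qed.

(** There are [n / d] multiples of [d] among the rows 1 to [n], each counted with weight [d]. The
    successor appears because rows start at 1. *)
Lemma sum_multiples d n : (0 < d)%nat ->
  (sum_below (fun r => if S r mod d =? 0 then d else 0) n <= n)%nat.
Proof.
  intros Hd. enough (sum_below (fun r => if S r mod d =? 0 then d else 0)%nat n <= d * (n / d))%nat.
  { pose proof (Nat.Div0.mul_div_le n d). lia. }
  induction n as [|n IH]; [simpl; lia|]. simpl sum_below.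
  pose proof (Nat.div_mod n d ltac:(lia)). pose proof (Nat.mod_upper_bound n d ltac:(lia)).
  destruct (Nat.eqb_spec (S n mod d) 0) as [E|E].
  - assert (S n / d = S (n / d))%nat; [|nia].
    pose proof (Nat.div_mod (S n) d ltac:(lia)) as D. rewrite E in D.
    assert (n / d < S n / d)%nat by (apply Nat.Div0.div_lt_upper_bound; lia).
    assert (S n / d < S (S (n / d)))%nat by (apply Nat.Div0.div_lt_upper_bound; nia). lia.
  - pose proof (Nat.Div0.div_le_mono n (S n) d ltac:(lia)). nia.
Qed.

Lemma sum_ruler k n : (sum_below (fun r => ruler k (S r)) n <= k * n)%nat.
Proof.
  induction k as [|k IH]; simpl.
  - clear. induction n; simpl; lia.
  - rewrite sum_below_add. pose proof (sum_multiples (2 ^ k) n).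
    pose proof (Nat.pow_nonzero 2 k). lia.
Qed.

(** Level [i] owns the rows after [band l a i] up to [band l a (S i)]. *)
Definition band (l : nat) (a : nat -> nat) (n : nat) : nat :=
  sum_below (fun i => a i / l + 1)%nat n.

Lemma band_le l a n : (0 < l)%nat -> (l * band l a n <= sum_below a n + l * n)%nat.
Proof.
  intros Hl. unfold band. induction n as [|n IH]; simpl; [lia|].
  pose proof (Nat.Div0.mul_div_le (a n) l). nia.
Qed.

Lemma band_mono l a i j : (i <= j)%nat -> (band l a i <= band l a j)%nat.
Proof. induction 1; auto. unfold band in *; simpl; lia. Qed.

(* Level [i] gets [a i / l + 1] consecutive rows, enough to contain a row whose number is a
   multiple of a power of two of at least half that size. *)
Definition level_row (l : nat) (a : nat -> nat) (i : nat) : nat :=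
  (2 ^ Nat.log2 (a i / l + 1) * (band l a (S i) / 2 ^ Nat.log2 (a i / l + 1)))%nat.

(** The chosen row is the last multiple of [d] in the block, and the block is at least [d] rows
    long. *)
Lemma level_row_bounds l a i : (band l a i < level_row l a i <= band l a (S i))%nat.
Proof.
  unfold level_row. set (d := (2 ^ Nat.log2 (a i / l + 1))%nat).
  assert (Hd : (d <= a i / l + 1)%nat) by (apply Nat.log2_spec; lia).
  assert (d <> 0)%nat by (apply Nat.pow_nonzero; lia).
  assert (E : band l a (S i) = (band l a i + (a i / l + 1))%nat) by reflexivity.
  pose proof (Nat.div_mod (band l a (S i)) d ltac:(lia)).
  pose proof (Nat.mod_upper_bound (band l a (S i)) d ltac:(lia)). lia.
Qed.

Lemma level_row_mono l a i j : (i < j)%nat -> (level_row l a i < level_row l a j)%nat.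
Proof.
  intros lt. pose proof (level_row_bounds l a i). pose proof (level_row_bounds l a j).
  pose proof (band_mono l a (S i) j lt). lia.
Qed.

(** The factor 2 is lost in rounding the block size [a i / l + 1] down to a power of two; rounding
    [a i / l] is paid for by the extra row. *)
Lemma level_row_ruler l a i k : (0 < l)%nat -> (Nat.log2 (a i / l + 1) < k)%nat ->
  (a i <= 2 * l * ruler k (level_row l a i))%nat.
Proof.
  intros Hl Hk. set (t := Nat.log2 (a i / l + 1)) in *.
  assert (G : (2 ^ t <= ruler k (level_row l a i))%nat).
  { apply ruler_ge; auto. unfold level_row. fold t.
    rewrite Nat.mul_comm. apply Nat.Div0.mod_mul. }
  assert (W : (a i / l + 1 < 2 * 2 ^ t)%nat).
  { pose proof (Nat.log2_spec (a i / l + 1) ltac:(lia)) as [_ H]. fold t in H. simpl in H. lia. }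
  pose proof (Nat.div_mod (a i) l ltac:(lia)). pose proof (Nat.mod_upper_bound (a i) l ltac:(lia)).
  nia.
Qed.

(** A block has at most [2 * l] rows, so exponents up to [log2 (2 l)] suffice. The minimum with [k]
    enforces the bound on abscissas and loses nothing, since no level has more than [k]
    crossings. *)
Definition universal_points (l k : nat) : list (Z * Z) :=
  flat_map (fun r => map (fun x => (Z.of_nat (S x), Z.of_nat (S r)))
    (seq 0 (Nat.min k (2 * l * ruler (S (Nat.log2 (2 * l))) (S r))))) (seq 0 (2 * l)).

Lemma universal_points_length l k :
  (length (universal_points l k) <= 4 * l * l * S (Nat.log2 (2 * l)))%nat.
Proof.
  unfold universal_points. set (c := S (Nat.log2 (2 * l))).
  set (F := fun r => map _ _).
  assert (HF : forall r, (length (F r) <= 2 * l * ruler c (S r))%nat).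
  { intros r. unfold F. rewrite length_map, length_seq. lia. }
  assert (H : forall n, (length (flat_map F (seq 0 n)) <=
    sum_below (fun r => 2 * l * ruler c (S r)) n)%nat).
  { clearbody F c. induction n as [|n IH]; [simpl; lia|].
    rewrite seq_S, flat_map_app, length_app.
    cbn [flat_map sum_below Nat.add]. rewrite app_nil_r. specialize (HF n). lia. }
  specialize (H (2 * l)%nat). rewrite sum_below_scale in H.
  pose proof (sum_ruler c (2 * l)). nia.
Qed.

Lemma in_universal_points l k x r :
  In (Z.of_nat x, Z.of_nat r) (universal_points l k) <->
  (1 <= x <= k /\ x <= 2 * l * ruler (S (Nat.log2 (2 * l))) r /\ 1 <= r <= 2 * l)%nat.
Proof.
  unfold universal_points. rewrite in_flat_map. split.
  - intros [r' [Hr H]]. apply in_map_iff in H. destruct H as [x' [E Hx]].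
    injection E as Ex Er.
    assert (x = S x') as -> by lia. assert (r = S r') as -> by lia.
    rewrite in_seq in *. lia.
  - intros [Hx [Hxr Hr]]. exists (r - 1)%nat. rewrite in_seq. split; [lia|].
    apply in_map_iff. exists (x - 1)%nat. replace (S (r - 1)) with r by lia.
    replace (S (x - 1)) with x by lia. rewrite in_seq. split; auto. lia.
Qed.

Lemma level_size_le_kappa l w i : (1 <= i <= l - 1)%nat -> (level_size w i <= kappa l w)%nat.
Proof.
  intros Hi. unfold kappa.
  assert (H : Forall (fun k => k <= list_max (map (level_size w) (seq 1 (l - 1))))%nat
    (map (level_size w) (seq 1 (l - 1)))) by (apply list_max_le; auto).
  rewrite Forall_forall in H. apply H, in_map, in_seq. lia.
Qed.

Lemma wiring_place_in l k w t : (0 < l)%nat -> (length w <= l * l)%nat ->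
  Forall (fun i => (1 <= i <= l - 1)%nat) w -> (kappa l w <= k)%nat -> (t < length w)%nat ->
  In (place (fun t => nth t w 0%nat) (fun t => Z.of_nat (rank w t))
        (fun i => Z.of_nat (level_row l (level_size w) i)) t) (universal_points l k).
Proof.
  intros Hl Hw Hf Hk Ht. unfold place. apply in_universal_points.
  pose proof (rank_bounds w t Ht) as Rb. rewrite Forall_forall in Hf.
  set (i := nth t w 0%nat) in *.
  assert (Hi : (1 <= i <= l - 1)%nat) by (apply Hf, nth_In; auto).
  pose proof (level_size_le_kappa l w i Hi).
  pose proof (level_row_bounds l (level_size w) i).
  pose proof (band_mono l (level_size w) (S i) l ltac:(lia)).
  pose proof (band_le l (level_size w) l Hl). pose proof (sum_below_count w l).
  (* The [l * l] crossings cost [l] rows in total, and the extra row per block another [l]. *)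
  assert (B : (band l (level_size w) l <= 2 * l)%nat) by nia.
  assert (Hlog : (Nat.log2 (level_size w i / l + 1) < S (Nat.log2 (2 * l)))%nat).
  { apply Nat.lt_succ_r, Nat.log2_le_mono.
    assert (E : band l (level_size w) (S i) = (band l (level_size w) i + (level_size w i / l + 1))%nat)
      by reflexivity. lia. }
  pose proof (level_row_ruler l (level_size w) i _ Hl Hlog). lia.
Qed.

(** * Edges of the arrangement are links of the drawing *)

Definition touches (p : nat * nat) (x : nat) : Prop := fst p = x \/ snd p = x.

Lemma crossing_pairs_length st w : length (crossing_pairs st w) = length w.
Proof. revert st; induction w as [|i w IH]; simpl; auto. Qed.

(** A wire at position [p] can only cross on levels [p] and [p + 1], and every crossing there
    involves it; so up to its next crossing both levels are idle. *)
Lemma next_on_track m st w x r :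
  wires m st -> Forall (fun i => (1 <= i <= m - 1)%nat) w -> (x < m)%nat -> (r < length w)%nat ->
  touches (nth r (crossing_pairs st w) (0, 0)%nat) x ->
  (forall s, (s < r)%nat -> ~ touches (nth s (crossing_pairs st w) (0, 0)%nat) x) ->
  (nth r w 0%nat = index x st \/ nth r w 0%nat = S (index x st)) /\
  forall s, (s < r)%nat -> nth s w 0%nat <> index x st /\ nth s w 0%nat <> S (index x st).
Proof.
  revert st r; induction w as [|i w IH]; intros st r W Hw Hx Hr; simpl in Hr; [lia|].
  inversion Hw as [|? ? Hi Hw']; subst. pose proof W as [nd [len mem]].
  assert (pos : forall p, (p < m)%nat -> nth p st 0%nat = x -> index x st = p).
  { intros p Hp <-. apply index_nth; auto. lia. }
  destruct r as [|r]; simpl.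
  - intros [E|E] _; apply pos in E; try lia; split; try (intros; lia); lia.
  - intros Ht gap. pose proof (gap 0%nat ltac:(lia)) as g0. simpl in g0.
    assert (n1 : nth (i - 1) st 0%nat <> x) by (intros F; apply g0; left; auto).
    assert (n2 : nth i st 0%nat <> x) by (intros F; apply g0; right; auto).
    assert (E : index x (swap_tracks st i) = index x st).
    { rewrite (index_swap_tracks m) by (auto; lia).
      destruct (Nat.eqb_spec x (nth (i - 1) st 0%nat)), (Nat.eqb_spec x (nth i st 0%nat)); congruence. }
    destruct (index_spec x st) as [_ Ex]; [apply mem; auto|].
    destruct (IH (swap_tracks st i) r) as [H1 H2]; auto; try lia.
    { apply wires_swap_tracks; auto; lia. }
    { intros s Hs. apply (gap (S s)). lia. }
    rewrite E in H1, H2. split; auto.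
    intros [|s] Hs; [|apply H2; lia]. split; intros F; rewrite F in *; auto.
    apply n1. rewrite <- Ex at 2. f_equal. lia.
Qed.

(** The witness [q] is the position of the wire between its two crossings. *)
Lemma consecutive_on_wire m st w x s t :
  wires m st -> Forall (fun i => (1 <= i <= m - 1)%nat) w -> (x < m)%nat ->
  (s < t < length w)%nat ->
  touches (nth s (crossing_pairs st w) (0, 0)%nat) x ->
  touches (nth t (crossing_pairs st w) (0, 0)%nat) x ->
  (forall r, (s < r < t)%nat -> ~ touches (nth r (crossing_pairs st w) (0, 0)%nat) x) ->
  exists q, (nth s w 0%nat = q \/ nth s w 0%nat = S q) /\
    (nth t w 0%nat = q \/ nth t w 0%nat = S q) /\
    forall r, (s < r < t)%nat -> nth r w 0%nat <> q /\ nth r w 0%nat <> S q.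
Proof.
  revert st s t; induction w as [|i w IH]; intros st s t W Hw Hx Hst; simpl in Hst; [lia|].
  inversion Hw as [|? ? Hi Hw']; subst. pose proof W as [nd [len mem]].
  destruct t as [|t]; [lia|].
  assert (W' : wires m (swap_tracks st i)) by (apply wires_swap_tracks; auto; lia).
  destruct s as [|s]; simpl.
  - intros Ts Tt gap.
    destruct (next_on_track m (swap_tracks st i) w x t) as [H1 H2]; auto; try lia.
    { intros r Hr. apply (gap (S r)). lia. }
    assert (E : index x (swap_tracks st i) = i \/ S (index x (swap_tracks st i)) = i).
    { rewrite (index_swap_tracks m) by (auto; lia).
      destruct Ts as [F|F]; simpl in F; rewrite <- F.
      - rewrite Nat.eqb_refl. auto.
      - rewrite Nat.eqb_refl. destruct (Nat.eqb _ _); [auto|right; lia]. }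
    exists (index x (swap_tracks st i)). split; [|split]; auto.
    + destruct E; auto.
    + intros [|r] Hr; [lia|]. apply H2; lia.
  - intros Ts Tt gap.
    destruct (IH (swap_tracks st i) s t) as [q [H1 [H2 H3]]]; auto; try lia.
    { intros r Hr. apply (gap (S r)). lia. }
    exists q; repeat split; auto; destruct r as [|r]; try lia; apply H3; lia.
Qed.

Lemma consecutive_link w row s t q :
  layout (length w) (fun t => nth t w 0%nat) (fun t => Z.of_nat (rank w t)) row ->
  (s < t < length w)%nat ->
  (nth s w 0%nat = q \/ nth s w 0%nat = S q) -> (nth t w 0%nat = q \/ nth t w 0%nat = S q) ->
  (forall r, (s < r < t)%nat -> nth r w 0%nat <> q /\ nth r w 0%nat <> S q) ->
  link (length w) (fun t => nth t w 0%nat) (fun t => Z.of_nat (rank w t)) s t \/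
  link (length w) (fun t => nth t w 0%nat) (fun t => Z.of_nat (rank w t)) t s.
Proof.
  intros [_ [succ _]] Hst Hs Ht gap.
  assert (c : nth s w 0%nat = nth t w 0%nat \/ nth t w 0%nat = S (nth s w 0%nat) \/
              nth s w 0%nat = S (nth t w 0%nat)) by lia.
  destruct c as [c|[c|c]].
  - left; left. repeat split; try lia. apply succ; auto.
    intros r Hr. pose proof (gap r Hr). simpl. lia.
  - left; right. repeat split; try lia; intros; pose proof (gap r ltac:(lia)); lia.
  - right; right. repeat split; try lia; intros; pose proof (gap r ltac:(lia)); lia.
Qed.

Lemma ForallOrdPairs_nth {A} (Q : A -> A -> Prop) l d s t :
  ForallOrdPairs Q l -> (s < t < length l)%nat -> Q (nth s l d) (nth t l d).
Proof.
  intros H; revert s t; induction H as [|x l Hx _ IH]; simpl; intros s t Hst; [lia|].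
  destruct t as [|t]; [lia|]. destruct s as [|s].
  - rewrite Forall_forall in Hx. apply Hx, nth_In. lia.
  - apply IH; lia.
Qed.

Lemma touches_joins p x : touches p x -> exists y, joins p x y.
Proof.
  destruct p as [a b]. intros [<-|<-]; simpl; [exists b; left|exists a; right]; auto.
Qed.

(** A repeated pair would have to precede itself on its own line. *)
Lemma chronological_NoDup T cp : chronological T cp -> NoDup cp.
Proof.
  induction 1 as [|p l Hp _ IH]; constructor; auto.
  intros Hin. rewrite Forall_forall in Hp. destruct p as [a b].
  apply (Rlt_irrefl (T a b)). apply (Hp _ Hin a b b); left; auto.
Qed.

Lemma pair_at_time cp a b :
  length (filter (same_pair a b) cp) = 1%nat ->
  exists t, (t < length cp)%nat /\ joins (nth t cp (0, 0)%nat) a b.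
Proof.
  intros H. destruct (filter (same_pair a b) cp) as [|p l] eqn:E; [discriminate|].
  assert (In p (filter (same_pair a b) cp)) as Hp by (rewrite E; left; auto).
  apply filter_In in Hp. destruct Hp as [Hp S]. apply same_pair_joins in S.
  apply (In_nth _ _ (0, 0)%nat) in Hp. destruct Hp as [t [Ht <-]]. eauto.
Qed.

Lemma arrangement_drawing m k L :
  (0 < m)%nat -> (forall w, is_wiring m w -> (kappa m w <= k)%nat) ->
  simple_arrangement m L -> exists f, drawing_into m L (universal_points m k) f.
Proof.
  intros m0 Hk SA.
  destruct (arrangement_consistent m L SA) as [h [T [E [Hh [con HT]]]]].
  destruct (wiring_of_consistent m T E m0 con) as [st [d [w [W [Hd [Hw [Hp Hch]]]]]]].
  set (cp := crossing_pairs (seq 0 m) w) in *.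
  destruct SA as [_ [Hcr Hsimple]].
  pose proof W as [nd [len mem]].
  pose proof Hw as [Hf Hpairs]. specialize (Hk w Hw).
  assert (Lcp : length cp = length w) by apply crossing_pairs_length.
  assert (W0 : wires m (seq 0 m)).
  { split; [apply seq_NoDup|split; [apply length_seq|]]. intros x; rewrite in_seq; lia. }
  (* A crude bound from distinctness of the pairs; the count of [2 * m] rows needs no better. *)
  assert (Lw : (length w <= m * m)%nat).
  { rewrite <- Lcp. replace (m * m)%nat with (length (list_prod (seq 0 m) (seq 0 m)))
      by (rewrite length_prod, !length_seq; auto).
    apply NoDup_incl_length; [apply (chronological_NoDup _ _ Hch)|].
    intros [a b] Hab. specialize (Hp _ Hab). simpl in Hp.
    apply in_prod; apply in_seq; lia. }
  set (line := fun a => nth a st 0%nat) in *.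
  assert (line_lt : forall a, (a < m)%nat -> (line a < m)%nat).
  { intros a Ha. apply mem, nth_In; lia. }
  assert (line_inj : forall a b, (a < m)%nat -> (b < m)%nat -> line a = line b -> a = b).
  { intros a b Ha Hb F. apply (proj1 (NoDup_nth st 0%nat) nd); auto; lia. }
  assert (line_onto : forall i, (i < m)%nat -> exists a, (a < m)%nat /\ line a = i).
  { intros i Hi. exists (index i st). rewrite <- len. apply index_spec, mem; auto. }
  change (chronological (fun a b => d (line a) * T (line a) (line b)) cp) in Hch.
  clearbody line.
  assert (cp_lt : forall t, (t < length w)%nat ->
    (fst (nth t cp (0, 0)%nat) < snd (nth t cp (0, 0)%nat) < m)%nat).
  { intros t Ht. apply Hp, nth_In. lia. }
  assert (joins_lt : forall t a b, (t < length w)%nat -> joins (nth t cp (0, 0)%nat) a b ->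
    (a < m /\ b < m /\ a <> b)%nat /\
    touches (nth t cp (0, 0)%nat) a /\ touches (nth t cp (0, 0)%nat) b).
  { intros t a b Ht J. pose proof (cp_lt t Ht) as C. unfold touches.
    destruct J as [F|F]; rewrite F in *; simpl in *; lia. }
  assert (meet_unique : forall i j u v, (i < m)%nat -> (j < m)%nat -> i <> j ->
    L i u -> L j u -> L i v -> L j v -> u = v).
  { intros i j u v Hi Hj ij Liu Lju Liv Ljv.
    destruct (Hcr i j Hi Hj ij) as [p [Hpq _]].
    transitivity p; [|symmetry]; apply Hpq; auto. }
  (* The time of a vertex is tied to the full set of lines through it; simplicity makes this set
     exactly the pair that crosses at that time. *)
  set (at_time := fun v t => (t < length w)%nat /\
    forall a, (a < m)%nat -> (L (line a) v <-> touches (nth t cp (0, 0)%nat) a)).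
  assert (time_exists : forall v, exists t, pa_vertex m L v -> at_time v t).
  { intros v. destruct (classic (pa_vertex m L v)) as [Hv|Hv]; [|exists 0%nat; tauto].
    destruct Hv as [i [j [Hi [Hj [ij [Li Lj]]]]]].
    destruct (line_onto i Hi) as [a [Ha <-]]. destruct (line_onto j Hj) as [b [Hb <-]].
    assert (ab : a <> b) by (intros ->; auto).
    assert (H : exists t, (t < length cp)%nat /\ joins (nth t cp (0, 0)%nat) a b).
    { destruct (Nat.lt_ge_cases a b).
      - apply pair_at_time, Hpairs. lia.
      - destruct (pair_at_time cp b a) as [t [Ht J]]; [apply Hpairs; lia|].
        exists t; split; auto. destruct J; [right|left]; auto. }
    destruct H as [t [Ht J]]. exists t. intros _. split; [lia|]. intros c Hc.
    assert (E' : touches (nth t cp (0, 0)%nat) c <-> c = a \/ c = b).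
    { unfold touches. destruct J as [-> | ->]; simpl; split; intros [?|?]; auto. }
    rewrite E'. split; [|intros [-> | ->]; auto].
    intros Lc. destruct (Nat.eq_dec c a); auto. destruct (Nat.eq_dec c b); auto. exfalso.
    apply (Hsimple (line a) (line b) (line a) (line c) v); auto.
    intros [[_ F]|[F _]]; apply line_inj in F; auto. }
  assert (time_point : forall u v t, at_time u t -> at_time v t -> u = v).
  { intros u v t [Ht Hu] [_ Hv]. pose proof (cp_lt t Ht) as C.
    assert (Ha : (fst (nth t cp (0, 0)%nat) < m)%nat) by lia.
    assert (Hb : (snd (nth t cp (0, 0)%nat) < m)%nat) by lia.
    apply (meet_unique (line (fst (nth t cp (0, 0)%nat))) (line (snd (nth t cp (0, 0)%nat))));
      auto; try (apply Hu; auto; unfold touches; auto; fail);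
      try (apply Hv; auto; unfold touches; auto; fail).
    intros F. apply line_inj in F; auto. lia. }
  destruct (functional_choice _ time_exists) as [time Htime].
  set (lev := fun t => nth t w 0%nat). set (x := fun t => Z.of_nat (rank w t)).
  set (row := fun i => Z.of_nat (level_row m (level_size w) i)).
  assert (lay : layout (length w) lev x row).
  { apply wiring_layout. intros i j _ _ lt. apply inj_lt, level_row_mono; auto. }
  assert (time_inj : forall u v, pa_vertex m L u -> pa_vertex m L v -> time u = time v -> u = v).
  { intros u v Hu Hv F. apply (time_point u v (time u)); [|rewrite F]; auto. }
  assert (edge_link : forall u v, pa_edge m L u v ->
    link (length w) lev x (time u) (time v) \/ link (length w) lev x (time v) (time u)).
  { intros u v [uv [Hu [Hv [i [h' [al [be [Hi [Hh' [Eu [Ev noV]]]]]]]]]]].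
    destruct (line_onto i Hi) as [a [Ha <-]].
    assert (Lu : L (line a) u) by (apply Hh'; eauto).
    assert (Lv : L (line a) v) by (apply Hh'; eauto).
    pose proof (Htime u Hu) as Au. pose proof (Htime v Hv) as Av.
    assert (st_ne : time u <> time v) by (intros F; apply uv, time_inj; auto).
    set (s := time u) in *. set (t := time v) in *. clearbody s t.
    pose proof (proj1 (proj2 Au a Ha) Lu) as Tu. pose proof (proj1 (proj2 Av a Ha) Lv) as Tv.
    destruct (touches_joins _ _ Tu) as [b Jb]. destruct (touches_joins _ _ Tv) as [e Je].
    destruct (joins_lt s a b (proj1 Au) Jb) as [[_ [Hb ab]] [_ Tb]].
    destruct (joins_lt t a e (proj1 Av) Je) as [[_ [He ae]] [_ Te]].
    assert (on : forall c, (c < m)%nat -> a <> c ->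
      L (line a) (h (line a) (T (line a) (line c), 0)) /\
      L (line c) (h (line a) (T (line a) (line c), 0)) /\ line a <> line c).
    { intros c Hc ac. split; [|split].
      - apply (Hh (line a)); eauto.
      - apply HT; auto.
      - intros F; apply line_inj in F; auto. }
    assert (Pu : u = h (line a) (T (line a) (line b), 0)).
    { destruct (on b Hb ab) as [o1 [o2 o3]].
      apply (meet_unique (line a) (line b)); auto; apply Au; auto. }
    assert (Pv : v = h (line a) (T (line a) (line e), 0)).
    { destruct (on e He ae) as [o1 [o2 o3]].
      apply (meet_unique (line a) (line e)); auto; apply Av; auto. }
    (* A crossing of [a] at an intermediate time lies between [u] and [v] on the line, by
       [chronological], in either direction of [d]; [param_between] carries it to the
       parametrization of the edge, which has no vertex there. *)
    assert (gap : forall r, (s < r < t \/ t < r < s)%nat -> ~ touches (nth r cp (0, 0)%nat) a).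
    { intros r Hr Tr. destruct (touches_joins _ _ Tr) as [c Jc].
      assert (Hrw : (r < length w)%nat) by (destruct Au, Av; lia).
      destruct (joins_lt r a c Hrw Jc) as [[_ [Hc ac]] _].
      assert (chr : forall s t b c, (s < t < length w)%nat -> joins (nth s cp (0, 0)%nat) a b ->
        joins (nth t cp (0, 0)%nat) a c ->
        d (line a) * T (line a) (line b) < d (line a) * T (line a) (line c)).
      { intros s' t' b' c' Hst J1 J2.
        apply (ForallOrdPairs_nth _ cp (0, 0)%nat s' t' Hch ltac:(lia) a b' c' J1 J2). }
      assert (btw : 0 < (T (line a) (line c) - T (line a) (line b)) *
                        (T (line a) (line e) - T (line a) (line c))).
      { destruct Hr as [Hr|Hr].
        - pose proof (chr s r b c ltac:(lia) Jb Jc).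
          pose proof (chr r t c e ltac:(destruct Av; lia) Jc Je).
          destruct (Hd (line a)) as [D|D]; rewrite D in *; nra.
        - pose proof (chr t r e c ltac:(lia) Je Jc).
          pose proof (chr r s c b ltac:(destruct Au; lia) Jc Jb).
          destruct (Hd (line a)) as [D|D]; rewrite D in *; nra. }
      destruct (param_between (L (line a)) (h (line a)) h' _ _ _ al be (Hh _ Hi) Hh'
        ltac:(rewrite <- Eu; exact Pu) ltac:(rewrite <- Ev; exact Pv) btw) as [ga [Eg Hg]].
      apply (noV ga); auto. rewrite Eg. destruct (on c Hc ac) as [o1 [o2 o3]].
      exists (line a), (line c). repeat split; auto. }
    destruct (Nat.lt_total s t) as [lt|[eq|lt]]; [|exfalso; exact (st_ne eq)|].
    - destruct (consecutive_on_wire m (seq 0 m) w a s t) as [q [H1 [H2 H3]]]; auto.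
      { destruct Av; lia. }
      apply (consecutive_link w row s t q); auto. destruct Av; lia.
    - destruct (consecutive_on_wire m (seq 0 m) w a t s) as [q [H1 [H2 H3]]]; auto.
      { destruct Au; lia. }
      apply or_comm. apply (consecutive_link w row t s q); auto. destruct Au; lia. }
  exists (fun v => place lev x row (time v)). split; [|split; [|split]].
  - intros v Hv. apply wiring_place_in; auto. apply Htime; auto.
  - intros u v Hu Hv F. apply time_inj; auto. injection F as Ex Er.
    pose proof (proj1 (Htime u Hu)) as Tu. pose proof (proj1 (Htime v Hv)) as Tv.
    apply (place_inj (length w) lev x row); auto.
    apply (row_inj (length w) lev x row); auto.
  - intros v a b Hv He va vb S.
    pose proof (proj1 (Htime v Hv)) as Tv.
    assert (H : time v = time a \/ time v = time b).
    { destruct (edge_link a b He) as [K|K].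
      - apply (link_vertex (length w) lev x row); auto.
      - apply or_comm, (link_vertex (length w) lev x row); auto. apply on_seg_sym; auto. }
    destruct He as [_ [Ha [Hb _]]].
    destruct H as [H|H]; apply time_inj in H; auto.
  - intros u v u' v' z He He' Z Z'.
    pose proof He as [_ [Hu [Hv _]]]. pose proof He' as [_ [Hu' [Hv' _]]].
    assert (done : forall a b a' b', pa_vertex m L a -> pa_vertex m L b ->
      pa_vertex m L a' -> pa_vertex m L b' ->
      meet_properly lev x row z (time a) (time b) (time a') (time b') ->
      (a = a' /\ b = b') \/
      exists y, (y = a \/ y = b) /\ (y = a' \/ y = b') /\ z = ipt (place lev x row (time y))).
    { intros a b a' b' Ha Hb Ha' Hb' [[F G]|[y [Y1 [Y2 Y3]]]].
      - left; split; apply time_inj; auto.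
      - right. destruct Y1 as [-> | ->].
        + exists a; repeat split; auto. destruct Y2; [left|right]; apply time_inj; auto.
        + exists b; repeat split; auto. destruct Y2; [left|right]; apply time_inj; auto. }
    pose proof (on_seg_sym _ _ _ Z) as Zs. pose proof (on_seg_sym _ _ _ Z') as Zs'.
    (* Links are directed and edges are not, hence four cases. *)
    destruct (edge_link u v He) as [K|K], (edge_link u' v' He') as [K'|K'];
      [destruct (done u v u' v') as [D|[y [D1 [D2 D3]]]]
      |destruct (done u v v' u') as [D|[y [D1 [D2 D3]]]]
      |destruct (done v u u' v') as [D|[y [D1 [D2 D3]]]]
      |destruct (done v u v' u') as [D|[y [D1 [D2 D3]]]]]; auto;
      try (apply (links_meet_properly (length w)); auto; fail);
      try (left; tauto); right; exists y; tauto.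
Qed.

(** * Counting the points *)

(** The number of vertices determines the number of lines, so a set built from [l] only has to serve
    arrangements of [l] lines. *)
Lemma triangular_inj m l : (3 <= l)%nat -> (m * (m - 1) / 2 = l * (l - 1) / 2)%nat -> m = l.
Proof.
  intros Hl E.
  assert (step : forall a b, (2 <= b)%nat -> (a < b)%nat -> (a * (a - 1) / 2 < b * (b - 1) / 2)%nat).
  { intros a b Hb Hab.
    assert (H : (a * (a - 1) + 2 * 1 <= b * (b - 1))%nat) by (destruct a, b; simpl; nia).
    apply (Nat.Div0.div_le_mono _ _ 2) in H.
    rewrite (Nat.mul_comm 2 1), Nat.div_add in H by lia. lia. }
  destruct (Nat.lt_total m l) as [lt|[|lt]]; auto.
  - specialize (step m l ltac:(lia) lt). lia.
  - specialize (step l m ltac:(lia) lt). lia.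
Qed.

Lemma one_le_ln x : 3 <= x -> 1 <= ln x.
Proof.
  intros H. rewrite <- (ln_exp 1). destruct (Rle_lt_or_eq_dec _ _ (Rle_trans _ _ _ exp_le_3 H)) as [lt|<-].
  - apply Rlt_le, ln_increasing; auto. apply exp_pos.
  - lra.
Qed.

Lemma log2_le_ln n : (1 <= n)%nat -> INR (Nat.log2 n) <= 2 * ln (INR n).
Proof.
  intros Hn. pose proof (Nat.log2_spec n ltac:(lia)) as [H _].
  apply le_INR in H. rewrite pow_INR in H. change (INR 2) with 2 in H.
  assert (P : 0 < 2 ^ Nat.log2 n) by (apply pow_lt; lra).
  assert (Q : ln (2 ^ Nat.log2 n) <= ln (INR n)).
  { destruct H as [H| <-]; [apply Rlt_le, ln_increasing; auto|lra]. }
  rewrite ln_pow in Q by lra.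
  (* This is [ln 4 >= 1], from [exp 1 <= 3]. *)
  assert (half : 1 <= 2 * ln 2).
  { replace (2 * ln 2) with (ln (2 ^ 2)) by (rewrite ln_pow by lra; simpl; lra).
    apply one_le_ln. lra. }
  pose proof (pos_INR (Nat.log2 n)). nra.
Qed.

Lemma universal_points_size l k : (3 <= l)%nat ->
  INR (length (universal_points l k)) <=
  48 * INR (l * (l - 1) / 2) * ln (INR (l * (l - 1) / 2)).
Proof.
  intros Hl. pose proof (universal_points_length l k) as H.
  set (n := (l * (l - 1) / 2)%nat).
  assert (Hn : (l * l <= 3 * n)%nat).
  { unfold n. pose proof (Nat.div_mod (l * (l - 1)) 2 ltac:(lia)).
    assert (Hev : (l * (l - 1) mod 2 = 0)%nat).
    { destruct (Nat.Even_or_Odd l) as [[c ->]|[c ->]].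
      - replace (2 * c * (2 * c - 1))%nat with ((c * (2 * c - 1)) * 2)%nat by ring.
        apply Nat.Div0.mod_mul.
      - replace ((2 * c + 1) * (2 * c + 1 - 1))%nat with (((2 * c + 1) * c) * 2)%nat.
        + apply Nat.Div0.mod_mul.
        + replace (2 * c + 1 - 1)%nat with (2 * c)%nat by lia. ring. }
    nia. }
  assert (ln_n : 1 <= ln (INR n)).
  { apply one_le_ln. replace 3 with (INR 3) by (simpl; lra). apply le_INR. nia. }
  assert (ln_l : ln (INR l) <= ln (INR n)).
  { assert (l <= n)%nat by nia. apply le_INR in H0.
    assert (0 < INR l) by (apply lt_0_INR; lia).
    destruct H0 as [H0|<-]; [apply Rlt_le, ln_increasing; auto|lra]. }
  apply le_INR in H. rewrite mult_INR, S_INR in H.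
  replace (Nat.log2 (2 * l)) with (S (Nat.log2 l)) in H by (symmetry; apply Nat.log2_double; lia).
  rewrite S_INR in H. pose proof (log2_le_ln l ltac:(lia)) as G.
  apply le_INR in Hn. rewrite mult_INR, mult_INR in Hn.
  rewrite !mult_INR in H. replace (INR 4) with 4 in H by (simpl; lra).
  replace (INR 3) with 3 in Hn by (simpl; lra).
  pose proof (pos_INR l). pose proof (pos_INR n).
  eapply Rle_trans; [exact H|].
  (* From [l * l <= 3 * n] and [log2 (2 l) + 1 <= 2 ln l + 2 <= 4 ln n]; the latter uses
     [ln n >= 1], true as [n >= 3]. The product gives the constant 48. *)
  apply Rle_trans with (4 * (3 * INR n) * (4 * ln (INR n))); [|lra].
  apply Rmult_le_compat; try nra.
  pose proof (pos_INR (Nat.log2 l)). lra.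
Qed.

Theorem theorem3 :
  exists C : R, C > 0 /\
  forall (l k : nat), (3 <= l)%nat -> is_kappa_max l k ->
  exists U : list (Z * Z),
    NoDup U /\
    INR (length U) <= C * INR (l * (l - 1) / 2) * ln (INR (l * (l - 1) / 2)) /\
    Forall (fun z => (1 <= fst z <= Z.of_nat k)%Z /\
                     1 <= IZR (snd z) <= C * INR l) U /\
    forall (m : nat) (L : nat -> R2 -> Prop),
      simple_arrangement m L -> (m * (m - 1) / 2 = l * (l - 1) / 2)%nat ->
      exists f : R2 -> Z * Z, drawing_into m L U f.
Proof.
  exists 48. split; [lra|]. intros l k Hl [_ Hk].
  assert (eq_dec : forall p q : Z * Z, {p = q} + {p <> q})
    by (intros; decide equality; apply Z.eq_dec).
  (* Removing duplicates can only shrink the list and keeps the same points. *)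
  exists (nodup eq_dec (universal_points l k)).
  split; [apply NoDup_nodup|split; [|split]].
  - eapply Rle_trans; [|apply universal_points_size; auto]. apply le_INR.
    apply NoDup_incl_length; [apply NoDup_nodup|]. intros z. apply nodup_In.
  - apply Forall_forall. intros z Hz. apply nodup_In in Hz.
    assert (E : exists x r, z = (Z.of_nat x, Z.of_nat r)).
    { unfold universal_points in Hz. apply in_flat_map in Hz. destruct Hz as [r [_ Hz]].
      apply in_map_iff in Hz. destruct Hz as [x [<- _]]. eauto. }
    destruct E as [x [r ->]]. apply in_universal_points in Hz. simpl.
    rewrite <- INR_IZR_INZ.
    destruct Hz as [Hx [_ [Hr1 Hr2]]]. apply le_INR in Hr1, Hr2.
    rewrite mult_INR in Hr2. simpl in Hr1, Hr2. pose proof (pos_INR l).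
    split; [lia|lra].
  - intros m L SA E. apply triangular_inj in E; auto. subst m.
    destruct (arrangement_drawing l k L ltac:(lia) Hk SA) as [f [F1 [F2 F3]]].
    exists f. split; auto. intros v Hv. apply nodup_In; auto.
Qed.
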